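(* Let $v_1,\dots,v_n\in\mathbb{R}^d$ and $1\le j\le d$. The function $c\mapsto\Gamma_j\big(\sum_{i=1}^n c_iv_iv_i^T\big)$ is concave on the feasible set $\{c\in\mathbb{R}^n: \sum_i c_i=j,\ c\ge 0\}$ (so the program below is a convex optimization problem), and the optimal value of \[ \text{(P)}\quad \text{minimize } \Delta_j(W)\ \text{ s.t. } v_i^TWv_i\le 1\ \forall i,\ W\succ 0 \] equals the optimal value of \[ \text{(D)}\quad \text{maximize } \Gamma_j\Big(\sum_{i=1}^n c_iv_iv_i^T\Big)\ \text{ s.t. } \sum_{i=1}^n c_i=j,\ c_i\ge 0\ \forall i. \]
   Context: For $W\succ 0$ with eigenvalues $\lambda_1\le\dots\le\lambda_d$, $\Delta_j(W)\coloneqq-\sum_{i=1}^j\ln\lambda_i$. For $x\in\mathbb{R}^d_+$ with $x_{(i)}$ its $i$-th largest coordinate, let $k$ be the unique integer with $0\le k\le j-1$ such that $x_{(k)}>\frac{1}{j-k}\sum_{i>k}x_{(i)}\ge x_{(k+1)}$ (with $x_{(0)}=\infty$), and $\gamma_j(x)\coloneqq\sum_{i=1}^k\ln x_{(i)}+(j-k)\ln\big(\frac{1}{j-k}\sum_{i=k+1}^d x_{(i)}\big)$, with the convention $\ln 0=-\infty$. For $X\succeq 0$ with eigenvalue vector $\lambda$, $\Gamma_j(X)\coloneqq\gamma_j(\lambda)$. The optimal value of (P) is its infimum and that of (D) its supremum (values in $\mathbb{R}\cup\{-\infty\}$). *)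

(* Defs.v *)
From Stdlib Require Import Reals Lra List Sorted.
Open Scope R_scope.

Fixpoint rsum (n : nat) (f : nat -> R) : R :=
  match n with O => 0 | S m => rsum m f + f m end.

(* d x d real matrices / vectors in R^d, indices 0..d-1 *)
Definition mat := nat -> nat -> R.
Definition vec := nat -> R.

Definition quad (d : nat) (W : mat) (x : vec) : R :=
  rsum d (fun a => rsum d (fun b => x a * W a b * x b)).

Definition symmetric (d : nat) (W : mat) : Prop :=
  forall a b, (a < d)%nat -> (b < d)%nat -> W a b = W b a.

Definition pos_def (d : nat) (W : mat) : Prop :=
  symmetric d W /\
  forall x : vec, (exists a, (a < d)%nat /\ x a <> 0) -> quad d W x > 0.

(* l is the list of eigenvalues (with multiplicity) of the symmetric matrix W,
   in ascending order l_0 <= ... <= l_{d-1}: W = U diag(l) U^T, U orthogonal. *)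
Definition eigvals (d : nat) (W : mat) (l : list R) : Prop :=
  symmetric d W /\ length l = d /\ Sorted Rle l /\
  exists U : mat,
    (forall a b, (a < d)%nat -> (b < d)%nat ->
       rsum d (fun k => U k a * U k b) = if Nat.eqb a b then 1 else 0) /\
    (forall a b, (a < d)%nat -> (b < d)%nat ->
       W a b = rsum d (fun k => U a k * nth k l 0 * U b k)).

(* Delta_j(W) = - sum_{i=1}^j ln lambda_i  (lambda ascending) *)
Definition Delta (j : nat) (l : list R) : R :=
  - rsum j (fun i => ln (nth i l 0)).

Inductive ereal := Fin (r : R) | NInf.

Definition ele (a b : ereal) : Prop :=
  match a, b with
  | NInf, _ => True
  | Fin _, NInf => False
  | Fin x, Fin y => x <= y
  end.

Definition eadd (a b : ereal) : ereal :=
  match a, b with Fin x, Fin y => Fin (x + y) | _, _ => NInf end.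

(* scaling by a positive real *)
Definition escale (t : R) (a : ereal) : ereal :=
  match a with Fin x => Fin (t * x) | NInf => NInf end.

Fixpoint esum (n : nat) (f : nat -> ereal) : ereal :=
  match n with O => Fin 0 | S m => eadd (esum m f) (f m) end.

(* ln with convention ln 0 = -∞ (used only for x >= 0) *)
Definition eln (x : R) : ereal :=
  if Rlt_dec 0 x then Fin (ln x) else NInf.

(* x_(i), the i-th largest entry (1 <= i <= d), from the ascending list l *)
Definition xo (d : nat) (l : list R) (i : nat) : R := nth (d - i) l 0.

Definition avg (d j : nat) (l : list R) (k : nat) : R :=
  / INR (j - k) * rsum (d - k) (fun m => xo d l (k + 1 + m)).

(* gamma_j(x) = g, where x is given by the ascending list l of its entries *)
Definition gamma_rel (d j : nat) (l : list R) (g : ereal) : Prop :=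
  exists k : nat,
    (k <= j - 1)%nat /\
    (k = O \/ xo d l k > avg d j l k) /\
    avg d j l k >= xo d l (k + 1) /\
    g = eadd (esum k (fun m => eln (xo d l (m + 1))))
             (escale (INR (j - k)) (eln (avg d j l k))).

Definition Gamma_rel (d j : nat) (X : mat) (g : ereal) : Prop :=
  exists l, eigvals d X l /\ gamma_rel d j l g.

Definition Xc (n : nat) (v : nat -> vec) (c : vec) : mat :=
  fun a b => rsum n (fun i => c i * v i a * v i b).

Definition Dfeasible (n j : nat) (c : vec) : Prop :=
  rsum n c = INR j /\ forall i, (i < n)%nat -> 0 <= c i.

Definition Pvals (n d j : nat) (v : nat -> vec) (t : ereal) : Prop :=
  exists W l, pos_def d W /\
    (forall i, (i < n)%nat -> quad d W (v i) <= 1) /\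
    eigvals d W l /\ t = Fin (Delta j l).

Definition Dvals (n d j : nat) (v : nat -> vec) (t : ereal) : Prop :=
  exists c, Dfeasible n j c /\ Gamma_rel d j (Xc n v c) t.

Definition is_inf (S : ereal -> Prop) (m : ereal) : Prop :=
  (forall s, S s -> ele m s) /\ (forall w, (forall s, S s -> ele w s) -> ele w m).

Definition is_sup (S : ereal -> Prop) (m : ereal) : Prop :=
  (forall s, S s -> ele s m) /\ (forall w, (forall s, S s -> ele s w) -> ele m w).

Definition Gamma_concave (n d j : nat) (v : nat -> vec) : Prop :=
  forall (c c' : vec) (t : R) (g g' g'' : ereal),
    Dfeasible n j c -> Dfeasible n j c' -> 0 < t < 1 ->
    Gamma_rel d j (Xc n v c) g -> Gamma_rel d j (Xc n v c') g' ->
    Gamma_rel d j (Xc n v (fun i => t * c i + (1 - t) * c' i)) g'' ->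
    ele (eadd (escale t g) (escale (1 - t) g')) g''.

(* Main.v *)
From Stdlib Require Import Reals Lra Lia List Sorted Classical Morphisms.
Require Import Defs.
Open Scope R_scope.

(** For fixed [X], [Gamma_j(X) = inf_W Delta_j(W) + tr (W X) - j] over positive
    definite [W]: [<=] is the trace inequality [tr (W X) >= sum_i w_i x_i] (the
    [w_i] ascending, the [x_i] descending) combined with [ln y <= y - 1], and a
    minimizing (sequence of) [W] shares the eigenvectors of [X] and has eigenvalues
    [1 / x_(1), ..., 1 / x_(k), 1 / b, ..., 1 / b], with [b] the average in
    [gamma_j], or [b] tending to 0 if this average vanishes.  Concavity of [Gamma_j]
    and weak duality follow at once.

    For strong duality, [{W | Delta_j(W) <= S}] is convex, where [S] bounds (D) from
    above, and by the formula every feasible [c] has a [W] in this set with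
    [sum_i c_i v_i^T W v_i <= j].  Multiplicative weights on [c] produce an average
    of such [W] that is feasible for (P) up to a factor arbitrarily close to 1. *)

(** * Finite sums *)

(** The set [{W | Delta_j(W) <= S}] is unbounded and either value may be -∞, so a compactness form
    of minimax does not apply directly. The form used is approximate and asks only for a convex set
    and for payoffs in a bounded interval.

    Boundedness is the real obstacle: where [c_i] is small, an answer [W] may have a huge
    [v_i^T W v_i]. Mixing a share [theta] of the uniform distribution into [c] bounds each payoff by
    [n / theta] and loses a factor [1 / (1 - theta)] in the averaged constraint. What remains is
    [v_i^T W v_i <= r] with [r] close to 1; dividing [W] by [r] restores feasibility and raises
    [Delta_j] by [j ln r], which tends to 0.

    The trace inequality is used twice: for the formula for [Gamma_j], and for the convexity of the
    sublevel sets of [Delta_j], through a linear lower bound. A spectral decomposition of arbitrary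
    symmetric matrices is needed for mixtures of [W]'s and for [Gamma_j] to have a value at every
    feasible [c]. *)

Lemma rsum_ext n f g :
  (forall i, (i < n)%nat -> f i = g i) -> rsum n f = rsum n g.
Proof.
  induction n as [|n IH]; simpl; intros H; [reflexivity|].
  rewrite IH, H by auto; reflexivity.
Qed.

(** Lets [setoid_rewrite] act under summation signs. *)
#[local] Instance rsum_proper :
  Proper (eq ==> pointwise_relation nat eq ==> eq) rsum.
Proof. intros n m <- f g H. apply rsum_ext. intros i _. apply H. Qed.

Lemma rsum_plus n f g : rsum n (fun i => f i + g i) = rsum n f + rsum n g.
Proof. induction n as [|n IH]; simpl; [lra|]. rewrite IH; lra. Qed.

Lemma rsum_scal n c f : rsum n (fun i => c * f i) = c * rsum n f.
Proof. induction n as [|n IH]; simpl; [lra|]. rewrite IH; lra. Qed.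

Lemma rsum_scal_r n c f : rsum n (fun i => f i * c) = rsum n f * c.
Proof. induction n as [|n IH]; simpl; [lra|]. rewrite IH; lra. Qed.

Lemma rsum_minus n f g : rsum n (fun i => f i - g i) = rsum n f - rsum n g.
Proof. induction n as [|n IH]; simpl; [lra|]. rewrite IH; lra. Qed.

Lemma rsum_const n c : rsum n (fun _ => c) = INR n * c.
Proof. induction n as [|n IH]; [simpl; lra|]. rewrite S_INR; simpl. rewrite IH; lra. Qed.

Lemma rsum_zero n f : (forall i, (i < n)%nat -> f i = 0) -> rsum n f = 0.
Proof.
  intros H. rewrite (rsum_ext n f (fun _ => 0)) by exact H.
  rewrite rsum_const; lra.
Qed.

Lemma rsum_le n f g :
  (forall i, (i < n)%nat -> f i <= g i) -> rsum n f <= rsum n g.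
Proof.
  induction n as [|n IH]; simpl; intros H; [lra|].
  specialize (H n (Nat.lt_succ_diag_r n)) as Hn.
  assert (rsum n f <= rsum n g) by (apply IH; intros; apply H; lia). lra.
Qed.

Lemma rsum_nonneg n f : (forall i, (i < n)%nat -> 0 <= f i) -> 0 <= rsum n f.
Proof.
  intros H. replace 0 with (rsum n (fun _ => 0)) by (apply rsum_zero; auto).
  now apply rsum_le.
Qed.

Lemma rsum_ge_term n f i :
  (forall i, (i < n)%nat -> 0 <= f i) -> (i < n)%nat -> f i <= rsum n f.
Proof.
  induction n as [|n IH]; simpl; intros H Hi; [lia|].
  destruct (Nat.eq_dec i n) as [->|Hne].
  - assert (0 <= rsum n f) by (apply rsum_nonneg; auto). lra.
  - assert (f i <= rsum n f) by (apply IH; [auto|lia]).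
    specialize (H n (Nat.lt_succ_diag_r n)). lra.
Qed.

Lemma rsum_eq0 n f :
  (forall i, (i < n)%nat -> 0 <= f i) -> rsum n f = 0 ->
  forall i, (i < n)%nat -> f i = 0.
Proof.
  intros H H0 i Hi. pose proof (rsum_ge_term n f i H Hi).
  specialize (H i Hi). lra.
Qed.

Lemma rsum_swap n m (f : nat -> nat -> R) :
  rsum n (fun i => rsum m (fun j => f i j)) =
  rsum m (fun j => rsum n (fun i => f i j)).
Proof.
  induction n as [|n IH]; simpl.
  - now rewrite rsum_zero.
  - now rewrite IH, <- rsum_plus.
Qed.

Lemma rsum_mul n m f g :
  rsum n f * rsum m g = rsum n (fun i => rsum m (fun j => f i * g j)).
Proof. setoid_rewrite rsum_scal. now rewrite rsum_scal_r. Qed.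

Lemma rsum_app n m f :
  rsum (n + m) f = rsum n f + rsum m (fun i => f (n + i)%nat).
Proof.
  induction m as [|m IH]; simpl.
  - rewrite Nat.add_0_r; lra.
  - rewrite Nat.add_succ_r; simpl. rewrite IH; lra.
Qed.

Lemma rsum_rev n f : rsum n (fun i => f (n - 1 - i)%nat) = rsum n f.
Proof.
  induction n as [|n IH]; [reflexivity|].
  change (S n) with (1 + n)%nat at 1. rewrite rsum_app; simpl.
  rewrite <- IH, Nat.sub_0_r, Nat.sub_0_r.
  rewrite (rsum_ext n _ (fun i => f (n - 1 - i)%nat)); [lra|].
  intros i Hi. f_equal; lia.
Qed.

Lemma rsum_delta n f b :
  (b < n)%nat -> rsum n (fun k => f k * (if Nat.eqb k b then 1 else 0)) = f b.
Proof.
  induction n as [|n IH]; simpl; intros Hb; [lia|].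
  destruct (Nat.eq_dec b n) as [->|Hne].
  - rewrite Nat.eqb_refl, rsum_zero; [lra|].
    intros i Hi. destruct (Nat.eqb_spec i n); [lia|lra].
  - rewrite IH by lia. destruct (Nat.eqb_spec n b); [lia|lra].
Qed.

Lemma rsum_swap4 n (F : nat -> nat -> nat -> nat -> R) :
  rsum n (fun a => rsum n (fun b => rsum n (fun k => rsum n (fun l => F a b k l)))) =
  rsum n (fun k => rsum n (fun l => rsum n (fun a => rsum n (fun b => F a b k l)))).
Proof.
  transitivity (rsum n (fun a => rsum n (fun k => rsum n (fun b =>
    rsum n (fun l => F a b k l))))).
  { apply rsum_ext; intros a _. apply rsum_swap. }
  rewrite rsum_swap. apply rsum_ext; intros k _.
  transitivity (rsum n (fun a => rsum n (fun l => rsum n (fun b => F a b k l)))).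
  { apply rsum_ext; intros a _. apply rsum_swap. }
  apply rsum_swap.
Qed.

(** * Orthonormal families and diagonalized matrices *)

Definition orthonormal (d : nat) (U : mat) : Prop :=
  forall a b, (a < d)%nat -> (b < d)%nat ->
    rsum d (fun k => U k a * U k b) = if Nat.eqb a b then 1 else 0.

Definition diag (d : nat) (U : mat) (w : nat -> R) : mat :=
  fun a b => rsum d (fun k => U a k * w k * U b k).

(** This is the trace of [A B^T], hence of [A B] for symmetric matrices. *)
Definition tr (d : nat) (A B : mat) : R :=
  rsum d (fun a => rsum d (fun b => A a b * B a b)).

Lemma tr_ext d A A' B B' :
  (forall a b, (a < d)%nat -> (b < d)%nat -> A a b = A' a b) ->
  (forall a b, (a < d)%nat -> (b < d)%nat -> B a b = B' a b) ->
  tr d A B = tr d A' B'.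
Proof.
  intros HA HB. apply rsum_ext; intros a Ha. apply rsum_ext; intros b Hb.
  now rewrite HA, HB.
Qed.

Lemma quad_ext d W W' x :
  (forall a b, (a < d)%nat -> (b < d)%nat -> W a b = W' a b) ->
  quad d W x = quad d W' x.
Proof.
  intros HA. apply rsum_ext; intros a Ha. apply rsum_ext; intros b Hb.
  now rewrite HA.
Qed.

(** The squared inner products of the two eigenbases appear as weights; for orthonormal bases they
    form a doubly stochastic matrix, which is what [rearrangement] takes. *)
Lemma tr_diag d U w Y x :
  tr d (diag d U w) (diag d Y x) =
  rsum d (fun k => rsum d (fun l => w k * x l * (rsum d (fun a => U a k * Y a l))^2)).
Proof.
  unfold tr, diag. setoid_rewrite rsum_mul. rewrite rsum_swap4.
  apply rsum_ext; intros k _. apply rsum_ext; intros l _.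
  simpl; rewrite Rmult_1_r, rsum_mul, <- rsum_scal.
  apply rsum_ext; intros a _. rewrite <- rsum_scal.
  apply rsum_ext; intros b _. ring.
Qed.

Lemma quad_diag d U w x :
  quad d (diag d U w) x = rsum d (fun k => w k * (rsum d (fun a => U a k * x a))^2).
Proof.
  unfold quad, diag.
  transitivity (rsum d (fun a => rsum d (fun k => rsum d (fun b =>
    w k * ((U a k * x a) * (U b k * x b)))))).
  { apply rsum_ext; intros a _. rewrite rsum_swap. apply rsum_ext; intros b _.
    rewrite <- rsum_scal, <- rsum_scal_r. apply rsum_ext; intros k _. ring. }
  rewrite rsum_swap. apply rsum_ext; intros k _.
  simpl; rewrite Rmult_1_r, rsum_mul, <- rsum_scal.
  apply rsum_ext; intros a _. now rewrite rsum_scal.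
Qed.

Lemma tr_diag_same d U w x :
  orthonormal d U ->
  tr d (diag d U w) (diag d U x) = rsum d (fun k => w k * x k).
Proof.
  intros HU. rewrite tr_diag. apply rsum_ext; intros k Hk.
  rewrite <- (rsum_delta d (fun l => w k * x l) k Hk).
  apply rsum_ext; intros l Hl. rewrite HU by assumption.
  rewrite (Nat.eqb_sym k l). destruct (Nat.eqb l k); ring.
Qed.

(* The squared Frobenius distance of [U U^T] and [1] is [d - 2 d + d = 0]. *)
Lemma orthonormal_rows d U :
  orthonormal d U -> orthonormal d (fun a b => U b a).
Proof.
  intros HU a b Ha Hb.
  set (M := diag d U (fun _ => 1)).
  assert (HM : forall a b, rsum d (fun k => U a k * U b k) = M a b).
  { intros. apply rsum_ext; intros; ring. }
  rewrite HM.
  set (e := fun a b : nat => if Nat.eqb a b then 1 else 0).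
  assert (H0 : rsum d (fun a => rsum d (fun b => (M a b - e a b)^2)) = 0).
  { transitivity (tr d M M - 2 * rsum d (fun a => M a a) + INR d).
    - unfold tr. rewrite <- (Rmult_1_r (INR d)), <- rsum_const, <- rsum_scal,
        <- rsum_minus, <- rsum_plus.
      apply rsum_ext; intros i Hi.
      replace 1 with (rsum d (fun b => 1 * (if Nat.eqb b i then 1 else 0)))
        by (now apply (rsum_delta d (fun _ => 1))).
      replace (M i i) with (rsum d (fun b => M i b * (if Nat.eqb b i then 1 else 0)))
        by (now apply (rsum_delta d (fun b => M i b))).
      rewrite <- rsum_scal, <- rsum_minus, <- rsum_plus.
      apply rsum_ext; intros l Hl. unfold e.
      rewrite (Nat.eqb_sym i l). destruct (Nat.eqb l i); ring.
    - unfold M at 1 2. rewrite tr_diag_same by assumption.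
      rewrite rsum_const.
      replace (rsum d (fun a => M a a)) with (INR d); [ring|].
      unfold M, diag. rewrite rsum_swap, <- (Rmult_1_r (INR d)), <- rsum_const.
      apply rsum_ext; intros k Hk.
      rewrite (rsum_ext d _ (fun i => U i k * U i k)) by (intros; ring).
      now rewrite (HU k k Hk Hk), Nat.eqb_refl. }
  assert (Hn : forall i, (i < d)%nat -> 0 <= rsum d (fun b => (M i b - e i b)^2)).
  { intros. apply rsum_nonneg; intros; apply pow2_ge_0. }
  pose proof (rsum_eq0 _ _ Hn H0 a Ha) as H1; simpl in H1.
  assert (H2 : (M a b - e a b)^2 = 0).
  { apply (rsum_eq0 d (fun b => (M a b - e a b)^2)); auto.
    intros; apply pow2_ge_0. }
  apply Rminus_diag_uniq. unfold e in H2. nra.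
Qed.
(** * The spectral theorem *)

Definition dot (d : nat) (x y : vec) : R := rsum d (fun a => x a * y a).

Definition mv (d : nat) (B : mat) (x : vec) : vec :=
  fun a => rsum d (fun b => B a b * x b).

Lemma quad_dot_mv d B x : quad d B x = dot d x (mv d B x).
Proof.
  unfold quad, dot, mv. setoid_rewrite <- rsum_scal.
  now setoid_rewrite Rmult_assoc.
Qed.

Lemma dot_ext d x x' y y' :
  (forall a, (a < d)%nat -> x a = x' a) -> (forall a, (a < d)%nat -> y a = y' a) ->
  dot d x y = dot d x' y'.
Proof. intros Hx Hy. apply rsum_ext; intros a Ha. now rewrite Hx, Hy. Qed.

Lemma dot_comm d x y : dot d x y = dot d y x.
Proof. apply rsum_ext; intros; ring. Qed.

Lemma dot_nonneg d x : 0 <= dot d x x.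
Proof. apply rsum_nonneg; intros; nra. Qed.

Lemma dot_eq0 d x : dot d x x = 0 -> forall a, (a < d)%nat -> x a = 0.
Proof.
  intros H a Ha.
  assert (x a * x a = 0).
  { apply (rsum_eq0 d (fun a => x a * x a)); auto. intros; nra. }
  nra.
Qed.

Lemma dot_delta d x a :
  (a < d)%nat -> dot d x (fun b => if Nat.eqb b a then 1 else 0) = x a.
Proof. apply rsum_delta. Qed.

Lemma mv_sym d B x y :
  symmetric d B -> dot d x (mv d B y) = dot d (mv d B x) y.
Proof.
  intros HB. unfold dot, mv. setoid_rewrite <- rsum_scal.
  setoid_rewrite <- rsum_scal_r. rewrite rsum_swap.
  apply rsum_ext; intros a Ha. apply rsum_ext; intros b Hb.
  rewrite HB by assumption; ring.
Qed.

Lemma mv_line d B x y t a :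
  mv d B (fun a => x a + t * y a) a = mv d B x a + t * mv d B y a.
Proof.
  unfold mv. rewrite <- rsum_scal, <- rsum_plus. apply rsum_ext; intros; ring.
Qed.

Lemma mv_scale d B t y a :
  mv d B (fun a => t * y a) a = t * mv d B y a.
Proof. unfold mv. rewrite <- rsum_scal. apply rsum_ext; intros; ring. Qed.

Lemma quad_line d B x y t :
  symmetric d B ->
  quad d B (fun a => x a + t * y a) =
  quad d B x + 2 * t * dot d y (mv d B x) + t^2 * quad d B y.
Proof.
  intros HB. rewrite !quad_dot_mv.
  transitivity (dot d x (mv d B x) + t * dot d x (mv d B y) +
    t * dot d y (mv d B x) + t^2 * dot d y (mv d B y)).
  - unfold dot. rewrite <- !rsum_scal, <- !rsum_plus.
    apply rsum_ext; intros a _. rewrite mv_line; ring.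
  - rewrite (mv_sym d B x y HB), (dot_comm d (mv d B x)); ring.
Qed.

Lemma quad_scale d B t x : quad d B (fun a => t * x a) = t^2 * quad d B x.
Proof.
  unfold quad. rewrite <- rsum_scal. apply rsum_ext; intros a _.
  rewrite <- rsum_scal. apply rsum_ext; intros b _. ring.
Qed.

Lemma dot_scale d t x : dot d (fun a => t * x a) (fun a => t * x a) = t^2 * dot d x x.
Proof. unfold dot. rewrite <- rsum_scal. apply rsum_ext; intros a _. ring. Qed.

Lemma slope_zero m q : (forall t, 0 <= 2 * t * m + t^2 * q) -> 0 <= q -> m = 0.
Proof.
  (* The minimizer would be [- m / q]; the added 1 covers [q = 0] and still leaves
     [- s^2 (2 + q) >= 0]. *)
  intros H Hq. specialize (H (- (m / (1 + q)))).
  set (s := m / (1 + q)) in *.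
  assert (Hm : m = s * (1 + q)) by (unfold s; field; lra).
  assert (s = 0) by nra. nra.
Qed.

(** A zero of a nonnegative form is a minimum, so the derivative in each coordinate direction [e]
    vanishes there. *)
Lemma psd_null d B x :
  symmetric d B -> (forall y, 0 <= quad d B y) -> quad d B x = 0 ->
  forall a, (a < d)%nat -> mv d B x a = 0.
Proof.
  intros HB Hp H0 a Ha.
  set (e := fun b => if Nat.eqb b a then 1 else 0).
  rewrite <- (dot_delta d (mv d B x) a Ha), dot_comm. fold e.
  apply (slope_zero _ (quad d B e)); [|apply Hp].
  intros t. specialize (Hp (fun a => x a + t * e a)).
  rewrite quad_line, H0 in Hp by assumption. lra.
Qed.

Lemma quad_S d B x :
  symmetric (S d) B ->
  quad (S d) B x =
  quad d B x + 2 * x d * rsum d (fun a => B a d * x a) + B d d * (x d)^2.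
Proof.
  intros HB. unfold quad; simpl. rewrite rsum_plus.
  replace (rsum d (fun b => x d * B d b * x b))
    with (x d * rsum d (fun a => B a d * x a)).
  2:{ rewrite <- rsum_scal. apply rsum_ext; intros b Hb.
      rewrite (HB d b) by lia; ring. }
  replace (rsum d (fun a => x a * B a d * x d))
    with (x d * rsum d (fun a => B a d * x a)).
  2:{ rewrite <- rsum_scal. apply rsum_ext; intros b Hb. ring. }
  ring.
Qed.

(** Completing the square in the last coordinate. *)
Lemma schur_complement d B x :
  symmetric (S d) B -> B d d <> 0 ->
  quad (S d) B x =
  quad d (fun a b => B a b - B a d * B b d / B d d) x
  + B d d * (x d + rsum d (fun a => B a d * x a) / B d d)^2.
Proof.
  intros HB Hd. rewrite quad_S by assumption.
  assert (H : quad d (fun a b => B a b - B a d * B b d / B d d) x =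
    quad d B x - (rsum d (fun a => B a d * x a))^2 / B d d).
  { unfold Rdiv; simpl; rewrite Rmult_1_r, rsum_mul, <- rsum_scal_r. unfold quad.
    rewrite <- rsum_minus. apply rsum_ext; intros a _.
    rewrite <- rsum_scal_r, <- rsum_minus. apply rsum_ext; intros b _. ring. }
  rewrite H. field. assumption.
Qed.

(** Cauchy-Schwarz with a crude constant, by induction from [(s + t)^2 <= 2 s^2 + 2 t^2]; only the
    existence of [K] matters. *)
Lemma linear_bound d f :
  exists K, 0 <= K /\ forall x, (rsum d (fun a => f a * x a))^2 <= K * dot d x x.
Proof.
  unfold dot. induction d as [|d [K [HK IH]]].
  - exists 0. split; [lra|]. intros x; simpl; lra.
  - exists (2 * K + 2 * (f d)^2). split; [nra|]. intros x; simpl.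
    specialize (IH x). pose proof (dot_nonneg d x) as Hn. unfold dot in Hn.
    set (s := rsum d (fun a => f a * x a)) in *.
    set (q := rsum d (fun a => x a * x a)) in *.
    pose proof (pow2_ge_0 (s - f d * x d)).
    assert (0 <= (f d)^2 * q) by (apply Rmult_le_pos; nra).
    assert (0 <= K * (x d)^2) by (apply Rmult_le_pos; nra).
    nra.
Qed.

Definition snoc (d : nat) (y : vec) (t : R) : vec :=
  fun a => if Nat.eqb a d then t else y a.

Lemma snoc_last d y t : snoc d y t d = t.
Proof. unfold snoc. now rewrite Nat.eqb_refl. Qed.

Lemma snoc_lt d y t a : (a < d)%nat -> snoc d y t a = y a.
Proof. intros H. unfold snoc. destruct (Nat.eqb_spec a d); [lia|reflexivity]. Qed.

Lemma quad_ext_r d B x y :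
  (forall a, (a < d)%nat -> x a = y a) -> quad d B x = quad d B y.
Proof.
  intros H. apply rsum_ext; intros a Ha. apply rsum_ext; intros b Hb.
  now rewrite !H.
Qed.

(** The last coordinate is chosen so that the completed square is exactly [t^2]; [t = 0] lifts a
    null vector of the Schur complement to one of [B]. *)
Lemma quad_snoc d B y t :
  symmetric (S d) B -> B d d <> 0 ->
  quad (S d) B (snoc d y (t - rsum d (fun a => B a d * y a) / B d d)) =
  quad d (fun a b => B a b - B a d * B b d / B d d) y + B d d * t^2.
Proof.
  intros HB Hd. rewrite schur_complement, snoc_last by assumption.
  rewrite (quad_ext_r d _ _ y) by (intros; now apply snoc_lt).
  rewrite (rsum_ext d (fun a => B a d * snoc _ _ _ a) (fun a => B a d * y a))
    by (intros; now rewrite snoc_lt).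
  f_equal. f_equal. f_equal. field. assumption.
Qed.

(** Stands in for compactness of the unit sphere: a nonnegative form that has no null vector is
    coercive. A zero corner entry gives a null basis vector; otherwise the Schur complement carries
    the induction. *)
Lemma psd_dichotomy d B :
  symmetric d B -> (forall x, 0 <= quad d B x) ->
  (exists x, 0 < dot d x x /\ quad d B x = 0) \/
  (exists m, 0 < m /\ forall x, m * dot d x x <= quad d B x).
Proof.
  revert B. induction d as [|d IH]; intros B HB Hp.
  { right. exists 1. split; [lra|]. intros x. unfold dot, quad; simpl; lra. }
  set (e := snoc d (fun _ => 0) 1).
  assert (He : quad (S d) B e = B d d).
  { rewrite quad_S by assumption. unfold e. rewrite snoc_last.
    rewrite (quad_ext_r d _ _ (fun _ => 0)) by (intros; now apply snoc_lt).
    rewrite rsum_zero by (intros; rewrite snoc_lt by assumption; ring).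
    unfold quad. rewrite rsum_zero; [ring|]. intros.
    apply rsum_zero; intros; ring. }
  assert (Hdd : 0 <= B d d) by (rewrite <- He; apply Hp).
  destruct (Req_dec (B d d) 0) as [H0|H0].
  { left. exists e. rewrite He. split; [|exact H0].
    unfold dot; simpl. unfold e at 3 4. rewrite snoc_last.
    pose proof (dot_nonneg d e) as Hn. unfold dot in Hn. lra. }
  destruct (IH (fun a b => B a b - B a d * B b d / B d d)) as [[y [Hy Hq]]|[m [Hm Hq]]].
  - intros a b Ha Hb. rewrite (HB a b) by lia. unfold Rdiv; ring.
  - intros y.
    pose proof (Hp (snoc d y (0 - rsum d (fun a => B a d * y a) / B d d))) as H.
    rewrite quad_snoc in H by assumption. lra.
  - left. exists (snoc d y (0 - rsum d (fun a => B a d * y a) / B d d)). split.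
    + unfold dot; simpl.
      rewrite (rsum_ext d _ (fun a => y a * y a)) by (intros; now rewrite snoc_lt).
      fold (dot d y y). rewrite snoc_last. nra.
    + rewrite quad_snoc, Hq by assumption. lra.
  - right. destruct (linear_bound d (fun a => B a d / B d d)) as [K [HK HKx]].
    (* From [x_d^2 <= 2 (x_d + l)^2 + 2 l^2] and [l^2 <= K |x|^2], the full squared norm is at most
       [(1 + 2 K) |x|^2 + 2 (x_d + l)^2], with [|x|] over the first [d] coordinates. The two
       arguments of [Rmin] match these two terms. *)
    exists (Rmin (m / (1 + 2 * K)) (B d d / 2)). split.
    { apply Rmin_glb_lt; [apply Rdiv_lt_0_compat|]; lra. }
    intros x. rewrite schur_complement by assumption.
    specialize (Hq x). specialize (HKx x).
    replace (rsum d (fun a => B a d * x a) / B d d)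
      with (rsum d (fun a => B a d / B d d * x a)).
    2:{ unfold Rdiv; rewrite <- rsum_scal_r. apply rsum_ext; intros; ring. }
    set (l := rsum d _) in *.
    change (dot (S d) x x) with (dot d x x + x d * x d).
    pose proof (dot_nonneg d x) as Hn.
    set (r := Rmin _ _).
    assert (Hr1 : r * (1 + 2 * K) <= m).
    { pose proof (Rmin_l (m / (1 + 2 * K)) (B d d / 2)) as H. fold r in H.
      apply (Rmult_le_compat_r (1 + 2 * K)) in H; [|lra].
      replace (m / (1 + 2 * K) * (1 + 2 * K)) with m in H by (field; lra). exact H. }
    assert (Hr2 : r * 2 <= B d d).
    { pose proof (Rmin_r (m / (1 + 2 * K)) (B d d / 2)) as H. fold r in H. lra. }
    assert (Hr : 0 <= r).
    { unfold r. apply Rmin_glb; [|lra]. apply Rlt_le, Rdiv_lt_0_compat; lra. }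
    assert (H1 : x d * x d <= 2 * (x d + l)^2 + 2 * (K * dot d x x)).
    { pose proof (pow2_ge_0 (x d + 2 * l)). nra. }
    apply (Rmult_le_compat_l r) in H1; [|exact Hr].
    apply (Rmult_le_compat_r (dot d x x)) in Hr1; [|exact Hn].
    apply (Rmult_le_compat_r ((x d + l)^2)) in Hr2; [|apply pow2_ge_0].
    lra.
Qed.

Lemma quad_shift d B mu x :
  quad d (fun a b => B a b - mu * (if Nat.eqb b a then 1 else 0)) x =
  quad d B x - mu * dot d x x.
Proof.
  unfold dot. rewrite <- rsum_scal. unfold quad. rewrite <- rsum_minus.
  apply rsum_ext; intros a Ha.
  rewrite (rsum_ext d _ (fun b => x a * B a b * x b -
    mu * x a * x b * (if Nat.eqb b a then 1 else 0))) by (intros; ring).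
  rewrite rsum_minus, (rsum_delta d (fun b => mu * x a * x b)) by assumption. ring.
Qed.

Lemma mv_shift d B mu x a :
  (a < d)%nat ->
  mv d (fun a b => B a b - mu * (if Nat.eqb b a then 1 else 0)) x a =
  mv d B x a - mu * x a.
Proof.
  intros Ha. unfold mv. rewrite <- (rsum_delta d x a Ha), <- rsum_scal, <- rsum_minus.
  apply rsum_ext; intros b _. ring.
Qed.

(** Makes the infimum of the form over the unit sphere finite. *)
Lemma quad_lower_bound d B x :
  dot d x x = 1 -> - rsum d (fun a => rsum d (fun b => Rabs (B a b))) <= quad d B x.
Proof.
  intros Hx.
  assert (H1 : forall a, (a < d)%nat -> Rabs (x a) <= 1).
  { intros a Ha. assert (x a * x a <= 1).
    { rewrite <- Hx. apply (rsum_ge_term d (fun a => x a * x a)); auto. intros; nra. }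
    apply Rabs_le. split; nra. }
  replace (- rsum d (fun a => rsum d (fun b => Rabs (B a b))))
    with (rsum d (fun a => rsum d (fun b => -1 * Rabs (B a b)))).
  2:{ setoid_rewrite rsum_scal. rewrite rsum_scal. ring. }
  apply rsum_le; intros a Ha. apply rsum_le; intros b Hb.
  assert (Rabs (x a * B a b * x b) <= Rabs (B a b)).
  { rewrite !Rabs_mult. pose proof (H1 a Ha). pose proof (H1 b Hb).
    pose proof (Rabs_pos (x a)). pose proof (Rabs_pos (x b)).
    pose proof (Rabs_pos (B a b)).
    assert (Rabs (x a) * Rabs (x b) <= 1) by nra. nra. }
  pose proof (Rle_abs (- (x a * B a b * x b))). rewrite Rabs_Ropp in *. lra.
Qed.

(* If [mu] is the infimum of the form on the unit sphere, [B - mu] is positive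
   semidefinite but not bounded below by a positive multiple of the identity. *)
Lemma min_eigenvector d B :
  symmetric d B -> (0 < d)%nat ->
  exists mu u, dot d u u = 1 /\
    (forall a, (a < d)%nat -> mv d B u a = mu * u a) /\
    (forall x, mu * dot d x x <= quad d B x).
Proof.
  intros HB Hd.
  destruct (completeness (fun r => exists x, dot d x x = 1 /\ r = - quad d B x))
    as [m [Hub Hlub]].
  - exists (rsum d (fun a => rsum d (fun b => Rabs (B a b)))).
    intros r [x [Hx ->]]. pose proof (quad_lower_bound d B x Hx). lra.
  - exists (- quad d B (fun b => if Nat.eqb b 0 then 1 else 0)).
    eexists. split; [|reflexivity]. now rewrite dot_delta.
  - assert (Hmin : forall x, - m * dot d x x <= quad d B x).
    { intros x. pose proof (dot_nonneg d x) as Hn.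
      destruct (Req_dec (dot d x x) 0) as [H0|H0].
      - rewrite H0. pose proof (dot_eq0 d x H0) as Hx.
        rewrite (quad_ext_r d B x (fun a => 0 * x a)) by (intros; rewrite Hx; auto; ring).
        rewrite quad_scale; lra.
      - set (t := / sqrt (dot d x x)).
        assert (Ht : t^2 * dot d x x = 1).
        { unfold t. rewrite pow_inv, pow2_sqrt by assumption. now field. }
        assert (Hu : - quad d B (fun a => t * x a) <= m).
        { apply Hub. eexists. split; [|reflexivity]. now rewrite dot_scale. }
        rewrite quad_scale in Hu.
        apply (Rmult_le_compat_r (dot d x x)) in Hu; [|lra].
        replace (- (t^2 * quad d B x) * dot d x x)
          with (- quad d B x * (t^2 * dot d x x)) in Hu by ring.
        rewrite Ht in Hu. lra. }
    set (C := fun a b => B a b - - m * (if Nat.eqb b a then 1 else 0)).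
    assert (HC : symmetric d C).
    { intros a b Ha Hb. unfold C. rewrite (HB a b), (Nat.eqb_sym b a) by assumption.
      reflexivity. }
    assert (HCp : forall x, 0 <= quad d C x).
    { intros x. unfold C. rewrite quad_shift. specialize (Hmin x). lra. }
    destruct (psd_dichotomy d C HC HCp) as [[x [Hx Hq]]|[m0 [Hm0 Hq]]].
    + set (t := / sqrt (dot d x x)).
      exists (- m), (fun a => t * x a). split; [|split; [|exact Hmin]].
      * rewrite dot_scale. unfold t. rewrite pow_inv, pow2_sqrt by lra. field; lra.
      * intros a Ha. rewrite mv_scale.
        pose proof (psd_null d C x HC HCp Hq a Ha) as H.
        unfold C in H. rewrite mv_shift in H by assumption.
        replace (mv d B x a) with (- m * x a) by lra. ring.
    + exfalso. assert (m <= m - m0); [|lra].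
      apply Hlub. intros r [x [Hx ->]]. specialize (Hq x).
      unfold C in Hq. rewrite quad_shift, Hx in Hq. lra.
Qed.

Lemma mv_plus_low_rank d A m (c : nat -> R) (U : mat) x a :
  mv d (fun a b => A a b + rsum m (fun i => c i * U a i * U b i)) x a =
  mv d A x a + rsum m (fun i => c i * U a i * dot d (fun k => U k i) x).
Proof.
  unfold mv, dot. setoid_rewrite <- rsum_scal. rewrite rsum_swap, <- rsum_plus.
  apply rsum_ext; intros b _. rewrite Rmult_plus_distr_r, <- rsum_scal_r.
  f_equal. apply rsum_ext; intros; ring.
Qed.

(* Pushing the eigenvalues already found up to a common large [N] makes the
   next smallest eigenvector orthogonal to the previous ones. *)
Lemma partial_spectral d A m :
  symmetric d A -> (m <= d)%nat ->
  exists (U : mat) (l : nat -> R),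
    (forall a b, (a < m)%nat -> (b < m)%nat ->
       dot d (fun k => U k a) (fun k => U k b) = if Nat.eqb a b then 1 else 0) /\
    (forall i a, (i < m)%nat -> (a < d)%nat ->
       mv d A (fun k => U k i) a = l i * U a i) /\
    (forall i x, (i < m)%nat ->
       (forall b, (b < i)%nat -> dot d (fun k => U k b) x = 0) ->
       l i * dot d x x <= quad d A x).
Proof.
  intros HA. induction m as [|m IH]; intros Hm.
  { exists (fun _ _ => 0), (fun _ => 0). repeat split; intros; lia. }
  destruct IH as (U & l & Hort & Heig & Hmin); [lia|].
  set (D := rsum d (fun a => A a a) - rsum m l).
  (* [B] has trace [D + m N]. If its least eigenvalue were at least [N], the trace would be at least
     [d N], forcing [(d - m) N <= D], which this [N] excludes. *)
  set (N := Rabs D + 1).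
  set (B := fun a b => A a b + rsum m (fun i => (N - l i) * U a i * U b i)).
  assert (HB : symmetric d B).
  { intros a b Ha Hb. unfold B. rewrite (HA a b) by assumption. f_equal.
    apply rsum_ext; intros; ring. }
  destruct (min_eigenvector d B HB) as (mu & u & Hu & Hmu & Hmumin); [lia|].
  assert (HmuN : mu < N).
  { apply Rnot_le_lt; intros Hle.
    assert (H1 : INR d * mu <= rsum d (fun a => B a a)).
    { rewrite <- rsum_const. apply rsum_le; intros a Ha.
      pose proof (Hmumin (fun b => if Nat.eqb b a then 1 else 0)) as H.
      rewrite dot_delta, Nat.eqb_refl, quad_dot_mv, dot_comm, dot_delta in H
        by assumption.
      unfold mv in H. rewrite rsum_delta in H by assumption. lra. }
    assert (H2 : rsum d (fun a => B a a) = D + INR m * N).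
    { unfold B, D. rewrite rsum_plus, rsum_swap.
      rewrite (rsum_ext m _ (fun i => N - l i)).
      - rewrite rsum_minus, rsum_const; ring.
      - intros i Hi. rewrite (rsum_ext d _ (fun k => (N - l i) * (U k i * U k i)))
          by (intros; ring).
        rewrite rsum_scal. pose proof (Hort i i Hi Hi) as H. unfold dot in H.
        rewrite H, Nat.eqb_refl. ring. }
    assert (H3 : INR m + 1 <= INR d) by (rewrite <- S_INR; now apply le_INR).
    pose proof (Rle_abs D). pose proof (Rabs_pos D).
    assert (INR d * N <= INR d * mu)
      by (apply Rmult_le_compat_l; [apply pos_INR|exact Hle]).
    assert ((INR m + 1) * N <= INR d * N) by (apply Rmult_le_compat_r; unfold N; lra).
    unfold N in *. lra. }
  (* [U_i] and [u] are eigenvectors of the symmetric [B] for the distinct eigenvalues [N] and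
     [mu]. *)
  assert (Hperp : forall i, (i < m)%nat -> dot d (fun k => U k i) u = 0).
  { intros i Hi.
    assert (HBi : forall a, (a < d)%nat -> mv d B (fun k => U k i) a = N * U a i).
    { intros a Ha. unfold B. rewrite mv_plus_low_rank, Heig by assumption.
      rewrite (rsum_ext m _ (fun k => (N - l k) * U a k * (if Nat.eqb k i then 1 else 0))).
      - rewrite (rsum_delta m (fun k => (N - l k) * U a k) i Hi). ring.
      - intros k Hk. now rewrite Hort. }
    pose proof (mv_sym d B (fun k => U k i) u HB) as H.
    assert (H1 : dot d (fun k => U k i) (mv d B u) = mu * dot d (fun k => U k i) u).
    { unfold dot. rewrite <- rsum_scal. apply rsum_ext; intros a Ha.
      rewrite Hmu by assumption. ring. }
    assert (H2 : dot d (mv d B (fun k => U k i)) u = N * dot d (fun k => U k i) u).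
    { unfold dot. rewrite <- rsum_scal. apply rsum_ext; intros a Ha.
      rewrite HBi by assumption. ring. }
    nra. }
  assert (HAB : forall x a, (forall i, (i < m)%nat -> dot d (fun k => U k i) x = 0) ->
    mv d A x a = mv d B x a).
  { intros x a Hx. unfold B. rewrite mv_plus_low_rank, rsum_zero; [ring|].
    intros i Hi. rewrite Hx by assumption. ring. }
  exists (fun k => snoc m (U k) (u k)), (snoc m l mu). split; [|split].
  - intros a b Ha Hb.
    destruct (Nat.eq_dec a m) as [->|Hne]; destruct (Nat.eq_dec b m) as [->|Hne'].
    + rewrite Nat.eqb_refl, <- Hu. apply dot_ext; intros; apply snoc_last.
    + destruct (Nat.eqb_spec m b); [lia|]. rewrite <- (Hperp b), dot_comm by lia.
      apply dot_ext; intros; [apply snoc_lt; lia|apply snoc_last].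
    + destruct (Nat.eqb_spec a m); [lia|]. rewrite <- (Hperp a) by lia.
      apply dot_ext; intros; [apply snoc_lt; lia|apply snoc_last].
    + rewrite <- Hort by lia. apply dot_ext; intros; apply snoc_lt; lia.
  - intros i a Hi Ha. destruct (Nat.eq_dec i m) as [->|Hne].
    + rewrite !snoc_last, <- Hmu, <- HAB by assumption.
      apply rsum_ext; intros. now rewrite snoc_last.
    + rewrite !snoc_lt, <- Heig by lia.
      apply rsum_ext; intros. now rewrite snoc_lt by lia.
  - intros i x Hi Hx. destruct (Nat.eq_dec i m) as [->|Hne].
    + rewrite snoc_last, quad_dot_mv.
      rewrite (dot_ext d x x (mv d A x) (mv d B x)); auto.
      * rewrite <- quad_dot_mv. apply Hmumin.
      * intros a _. apply HAB. intros b Hb. rewrite <- (Hx b Hb).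
        apply dot_ext; intros; [now rewrite snoc_lt|reflexivity].
    + rewrite snoc_lt by lia. apply Hmin; [lia|].
      intros b Hb. rewrite <- (Hx b Hb).
      apply dot_ext; intros; [now rewrite snoc_lt by lia|reflexivity].
Qed.

Theorem spectral_theorem d A :
  symmetric d A ->
  exists U l, orthonormal d U /\
    (forall a b, (a < d)%nat -> (b < d)%nat -> A a b = diag d U l a b) /\
    (forall a b, (a <= b)%nat -> (b < d)%nat -> l a <= l b).
Proof.
  intros HA.
  destruct (partial_spectral d A d HA (le_n d)) as (U & l & Hort & Heig & Hmin).
  exists U, l. split; [exact Hort|split].
  - intros a b Ha Hb. pose proof (orthonormal_rows d U Hort) as Hrow.
    rewrite <- (rsum_delta d (A a) b Hb).
    transitivity (rsum d (fun c => rsum d (fun k => A a c * U c k * U b k))).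
    + apply rsum_ext; intros c Hc. rewrite <- (Hrow c b) by assumption.
      rewrite <- rsum_scal. apply rsum_ext; intros; ring.
    + rewrite rsum_swap. apply rsum_ext; intros k Hk.
      rewrite rsum_scal_r. rewrite (Rmult_comm (U a k)), <- Heig by assumption.
      reflexivity.
  (* Column [b] is orthogonal to all columns before [a], so the minimality of [l a] applies to it,
     and the form there equals [l b]. *)
  - intros a b Hab Hb. destruct (Nat.eq_dec a b) as [->|Hne]; [lra|].
    pose proof (Hmin a (fun k => U k b)) as H.
    rewrite quad_dot_mv in H.
    rewrite (dot_ext d _ (fun k => U k b) (mv d A (fun k => U k b)) (fun k => l b * U k b)) in H
      by (intros; auto).
    rewrite Hort, Nat.eqb_refl in H by lia.
    assert (Hd : dot d (fun k => U k b) (fun k => l b * U k b) = l b).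
    { transitivity (l b * dot d (fun k => U k b) (fun k => U k b)).
      - unfold dot. rewrite <- rsum_scal. apply rsum_ext; intros; ring.
      - rewrite Hort, Nat.eqb_refl by lia. ring. }
    rewrite Hd in H. rewrite Rmult_1_r in H. apply H; [lia|].
    intros c Hc. rewrite Hort by lia. destruct (Nat.eqb_spec c b); [lia|reflexivity].
Qed.
Lemma parseval d Y x :
  orthonormal d Y ->
  rsum d (fun l => (rsum d (fun a => Y a l * x a))^2) = dot d x x.
Proof.
  intros HY.
  transitivity (quad d (diag d Y (fun _ => 1)) x).
  { rewrite quad_diag. apply rsum_ext; intros; ring. }
  apply rsum_ext; intros a Ha.
  transitivity (rsum d (fun b => x a * x b * (if Nat.eqb b a then 1 else 0))).
  - apply rsum_ext; intros b Hb. unfold diag.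
    rewrite (rsum_ext d _ (fun k => Y b k * Y a k)) by (intros; ring).
    rewrite (orthonormal_rows d Y HY b a) by assumption. ring.
  - now rewrite (rsum_delta d (fun b => x a * x b)).
Qed.

(** * The trace inequality *)

Definition nondecreasing (d : nat) (w : nat -> R) : Prop :=
  forall a b, (a <= b)%nat -> (b < d)%nat -> w a <= w b.

Definition nonincreasing (d : nat) (x : nat -> R) : Prop :=
  forall a b, (a <= b)%nat -> (b < d)%nat -> x b <= x a.

(* Dual potentials [alpha_k + beta_l <= w_k x_l], tight on the diagonal, for the
   assignment problem with cost [w_k x_l]. *)
Lemma rearrangement d w x (P : mat) :
  nondecreasing d w -> nonincreasing d x ->
  (forall k l, 0 <= P k l) ->
  (forall k, (k < d)%nat -> rsum d (fun l => P k l) = 1) ->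
  (forall l, (l < d)%nat -> rsum d (fun k => P k l) = 1) ->
  rsum d (fun k => w k * x k) <=
  rsum d (fun k => rsum d (fun l => w k * x l * P k l)).
Proof.
  intros Hw Hx HP Hrow Hcol.
  (* A discrete integral of [x] against [w]; the other potential is [beta_l = w_l x_l - alpha_l]. As
     [x] is nonincreasing, replacing it by the constant [x_l] between [k] and [l] errs in the
     required direction on either side. *)
  set (alpha := fun a => rsum a (fun i => (w (S i) - w i) * x i)).
  assert (H1 : forall l k, (l <= k)%nat -> (k < d)%nat ->
    alpha k - alpha l <= (w k - w l) * x l).
  { intros l k Hlk. induction Hlk as [|k Hlk IH]; intros Hk; [lra|].
    assert (alpha k - alpha l <= (w k - w l) * x l) by (apply IH; lia).
    change (alpha (S k)) with (alpha k + (w (S k) - w k) * x k).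
    assert (w k <= w (S k)) by (apply Hw; lia).
    assert (x k <= x l) by (apply Hx; lia). nra. }
  assert (H2 : forall k l, (k <= l)%nat -> (l < d)%nat ->
    (w l - w k) * x l <= alpha l - alpha k).
  { intros k l Hkl. induction Hkl as [|l Hkl IH]; intros Hl; [lra|].
    assert ((w l - w k) * x l <= alpha l - alpha k) by (apply IH; lia).
    change (alpha (S l)) with (alpha l + (w (S l) - w l) * x l).
    assert (w l <= w (S l)) by (apply Hw; lia).
    assert (w k <= w l) by (apply Hw; lia).
    assert (x (S l) <= x l) by (apply Hx; lia). nra. }
  apply Rle_trans with (rsum d (fun k => rsum d (fun l =>
    (alpha k + (w l * x l - alpha l)) * P k l))).
  - right. symmetry.
    transitivity (rsum d (fun k => rsum d (fun l => alpha k * P k l)) +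
      rsum d (fun k => rsum d (fun l => (w l * x l - alpha l) * P k l))).
    { rewrite <- rsum_plus. apply rsum_ext; intros k _. rewrite <- rsum_plus.
      apply rsum_ext; intros l _. ring. }
    rewrite (rsum_swap d d (fun k l => (w l * x l - alpha l) * P k l)).
    rewrite <- rsum_plus. apply rsum_ext; intros k Hk.
    rewrite !rsum_scal, Hrow, Hcol by assumption. ring.
  - apply rsum_le; intros k Hk. apply rsum_le; intros l Hl.
    apply Rmult_le_compat_r; [apply HP|].
    destruct (Nat.le_ge_cases k l) as [Hkl|Hkl].
    + specialize (H2 k l Hkl Hl). lra.
    + specialize (H1 l k Hkl Hk). lra.
Qed.

(** [parseval], applied to the columns of each basis in terms of the other, gives row and column
    sums 1 for the weights of [tr_diag]. *)
Lemma trace_inequality d U w Y x :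
  orthonormal d U -> orthonormal d Y -> nondecreasing d w -> nonincreasing d x ->
  rsum d (fun k => w k * x k) <= tr d (diag d U w) (diag d Y x).
Proof.
  intros HU HY Hw Hx. rewrite tr_diag.
  apply (rearrangement d w x (fun k l => (rsum d (fun a => U a k * Y a l))^2)); auto.
  - intros; apply pow2_ge_0.
  - intros k Hk.
    rewrite (rsum_ext d _ (fun l => (rsum d (fun a => Y a l * U a k))^2)).
    + rewrite (parseval d Y (fun a => U a k) HY). unfold dot.
      rewrite (HU k k), Nat.eqb_refl; auto.
    + intros l _. f_equal. apply rsum_ext; intros; ring.
  - intros l Hl. rewrite (parseval d U (fun a => Y a l) HU). unfold dot.
    rewrite (HY l l), Nat.eqb_refl; auto.
Qed.

(** * Spectra and positive definiteness *)

(** [eigvals] with the eigenvectors exposed and a function in place of the list. *)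
Definition spectrum (d : nat) (W U : mat) (w : nat -> R) : Prop :=
  orthonormal d U /\
  (forall a b, (a < d)%nat -> (b < d)%nat -> W a b = diag d U w a b) /\
  nondecreasing d w.

Lemma spectrum_symmetric d W U w : spectrum d W U w -> symmetric d W.
Proof.
  intros (_ & HW & _) a b Ha Hb. rewrite !HW by assumption.
  apply rsum_ext; intros; ring.
Qed.

Lemma spectrum_quad_col d W U w k :
  spectrum d W U w -> (k < d)%nat -> quad d W (fun a => U a k) = w k.
Proof.
  intros (HU & HW & _) Hk. rewrite (quad_ext d W _ _ HW), quad_diag.
  rewrite <- (rsum_delta d w k Hk). apply rsum_ext; intros l Hl.
  rewrite HU by assumption. destruct (Nat.eqb l k); ring.
Qed.

Lemma spectrum_pos_iff d W U w :
  spectrum d W U w ->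
  (pos_def d W <-> forall k, (k < d)%nat -> 0 < w k).
Proof.
  intros HS. pose proof HS as (HU & HW & _). split.
  - intros [_ Hp] k Hk. rewrite <- (spectrum_quad_col d W U w k HS Hk).
    apply Hp. apply NNPP; intros Hn.
    assert (dot d (fun a => U a k) (fun a => U a k) = 0).
    { apply rsum_zero; intros a Ha.
      destruct (Req_dec (U a k) 0) as [->|H]; [ring|]. exfalso; eauto. }
    unfold dot in *. rewrite HU, Nat.eqb_refl in * by assumption. lra.
  - intros Hw. split; [eapply spectrum_symmetric; eauto|].
    intros x (a & Ha & Hx). rewrite (quad_ext d W _ _ HW), quad_diag.
    set (f := fun k => w k * (rsum d (fun a => U a k * x a))^2).
    assert (Hf : forall k, (k < d)%nat -> 0 <= f k).
    { intros k Hk. apply Rmult_le_pos; [apply Rlt_le; auto|apply pow2_ge_0]. }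
    destruct (rsum_nonneg d f Hf) as [H|H]; [exact H|].
    exfalso. apply Hx, (dot_eq0 d x); [|exact Ha].
    rewrite <- (parseval d U x HU). apply rsum_zero; intros k Hk.
    pose proof (rsum_eq0 d f Hf (eq_sym H) k Hk) as H0. unfold f in H0.
    specialize (Hw k Hk). apply Rmult_integral in H0. destruct H0; [lra|assumption].
Qed.

Lemma StronglySorted_nth l :
  StronglySorted Rle l -> nondecreasing (length l) (fun k => nth k l 0).
Proof.
  induction 1 as [|x l Hl IH Hx]; intros a b Hab Hb; simpl in Hb; [lia|].
  destruct a as [|a], b as [|b]; simpl; try lia; [lra| |].
  - rewrite Forall_forall in Hx. apply Hx, nth_In. lia.
  - apply IH; lia.
Qed.

Lemma eigvals_spectrum d W l :
  eigvals d W l -> exists U, spectrum d W U (fun k => nth k l 0).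
Proof.
  intros (_ & Hlen & Hs & U & HU & HW). exists U. repeat split; auto.
  rewrite <- Hlen. apply StronglySorted_nth, Sorted_StronglySorted; [|exact Hs].
  intros x y z; apply Rle_trans.
Qed.

Lemma nth_map_seq d (w : nat -> R) k :
  (k < d)%nat -> nth k (map w (seq 0 d)) 0 = w k.
Proof.
  intros Hk. rewrite nth_indep with (d' := w 0%nat) by (rewrite length_map, length_seq; lia).
  rewrite map_nth, seq_nth by lia. reflexivity.
Qed.

Lemma Sorted_map_seq (w : nat -> R) s n :
  nondecreasing (s + n) w -> Sorted Rle (map w (seq s n)).
Proof.
  revert s. induction n as [|n IH]; intros s Hw; simpl; constructor.
  - apply IH. now rewrite Nat.add_succ_l, <- Nat.add_succ_r.
  - destruct n; simpl; constructor. apply Hw; lia.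
Qed.

Lemma spectrum_eigvals d W U w :
  spectrum d W U w -> eigvals d W (map w (seq 0 d)).
Proof.
  intros HS. pose proof HS as (HU & HW & Hw).
  split; [eapply spectrum_symmetric; eauto|split; [|split]].
  - now rewrite length_map, length_seq.
  - now apply Sorted_map_seq.
  - exists U. split; [exact HU|]. intros a b Ha Hb. rewrite HW by assumption.
    apply rsum_ext; intros k Hk. now rewrite nth_map_seq.
Qed.

Lemma Delta_map_seq d j w :
  (j <= d)%nat -> Delta j (map w (seq 0 d)) = - rsum j (fun i => ln (w i)).
Proof.
  intros Hj. unfold Delta. f_equal. apply rsum_ext; intros i Hi.
  rewrite nth_map_seq; [reflexivity|lia].
Qed.

Lemma symmetric_spectrum d W : symmetric d W -> exists U w, spectrum d W U w.
Proof. intros HW. destruct (spectral_theorem d W HW) as (U & l & H). now exists U, l. Qed.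

Lemma eigvals_descending d X l :
  eigvals d X l ->
  exists Y, orthonormal d Y /\
    (forall a b, (a < d)%nat -> (b < d)%nat ->
       X a b = diag d Y (fun i => xo d l (i + 1)) a b) /\
    nonincreasing d (fun i => xo d l (i + 1)).
Proof.
  intros H. destruct (eigvals_spectrum d X l H) as (U & HU & HX & Hl).
  (* The columns are reversed to follow the descending order; [xo] counts from 1, hence the shift
     [i + 1]. *)
  exists (fun a k => U a (d - 1 - k)%nat). split; [|split].
  - intros a b Ha Hb. rewrite HU by lia.
    destruct (Nat.eqb_spec a b) as [->|Hne]; [now rewrite Nat.eqb_refl|].
    destruct (Nat.eqb_spec (d - 1 - a) (d - 1 - b)); [lia|reflexivity].
  - intros a b Ha Hb. rewrite HX by assumption. unfold diag, xo.
    rewrite <- rsum_rev. apply rsum_ext; intros k Hk.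
    replace (d - (k + 1))%nat with (d - 1 - k)%nat by lia. reflexivity.
  - intros a b Hab Hb. unfold xo. apply Hl; lia.
Qed.

(** * The variational formula for Gamma_j *)

Lemma ln_le_sub1 y : 0 < y -> ln y <= y - 1.
Proof.
  intros Hy. pose proof (exp_ineq1_le (ln y)) as H.
  rewrite exp_ln in H by exact Hy. lra.
Qed.

(* Here [j = k + r] and [d = k + r + s]. *)
Lemma gamma_upper k r s x w a :
  nonincreasing (k + r + s) x -> nondecreasing (k + r + s) w ->
  (forall i, (i < k + r + s)%nat -> 0 < w i) ->
  (forall i, (i < k + r + s)%nat -> 0 <= x i) ->
  (forall i, (i < k)%nat -> 0 < x i) -> 0 < a -> (1 <= r)%nat ->
  INR r * a = rsum (r + s) (fun m => x (k + m)%nat) -> x k <= a ->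
  rsum k (fun i => ln (x i)) + INR r * ln a <=
  rsum (k + r + s) (fun i => w i * x i) - INR (k + r)
  - rsum (k + r) (fun i => ln (w i)).
Proof.
  intros Hx Hw Hwp Hx0 Hxp Ha Hr Havg Hxk.
  rewrite !rsum_app in *. rewrite plus_INR.
  assert (H1 : rsum k (fun i => ln (x i)) <=
    rsum k (fun i => w i * x i) - INR k - rsum k (fun i => ln (w i))).
  { rewrite <- (Rmult_1_r (INR k)), <- rsum_const, <- !rsum_minus.
    apply rsum_le; intros i Hi.
    assert (0 < w i) by (apply Hwp; lia). specialize (Hxp i Hi).
    pose proof (ln_le_sub1 (w i * x i) ltac:(now apply Rmult_lt_0_compat)) as H0.
    rewrite ln_mult in H0 by assumption. lra. }
  assert (H2 : INR r * ln a <= a * rsum r (fun m => w (k + m)%nat) - INR r -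
    rsum r (fun m => ln (w (k + m)%nat))).
  { rewrite <- rsum_const, <- (Rmult_1_r (INR r)), <- (rsum_const r 1),
      <- rsum_scal, <- !rsum_minus.
    apply rsum_le; intros m Hm.
    assert (0 < w (k + m)%nat) by (apply Hwp; lia).
    pose proof (ln_le_sub1 (a * w (k + m)%nat) ltac:(now apply Rmult_lt_0_compat)) as H0.
    rewrite ln_mult in H0 by assumption. lra. }
  (* The pivot [t] is at least each weight in the middle block and at most each weight in the tail.
     Raising the middle entries to [a] takes exactly the mass of the tail, so moving that mass
     forward does not increase the weighted sum: [H3] bounds the cost of the raise, [H4] the
     saving. *)
  set (t := w (k + r - 1)%nat).
  assert (H3 : rsum r (fun m => w (k + m)%nat * (a - x (k + m)%nat)) <=
    t * rsum r (fun m => a - x (k + m)%nat)).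
  { rewrite <- rsum_scal. apply rsum_le; intros m Hm. apply Rmult_le_compat_r.
    - assert (x (k + m)%nat <= x k) by (apply Hx; lia). lra.
    - apply Hw; lia. }
  assert (H4 : t * rsum s (fun m => x (k + (r + m))%nat) <=
    rsum s (fun m => w (k + r + m)%nat * x (k + r + m)%nat)).
  { rewrite <- rsum_scal. apply rsum_le; intros m Hm. rewrite Nat.add_assoc.
    apply Rmult_le_compat_r; [apply Hx0; lia|apply Hw; lia]. }
  rewrite (rsum_ext r (fun m => _ * (a - _))
    (fun m => a * w (k + m)%nat - w (k + m)%nat * x (k + m)%nat)) in H3
    by (intros; ring).
  rewrite !rsum_minus, rsum_scal, rsum_const in H3.
  replace (INR r * a - rsum r (fun m => x (k + m)%nat))
    with (rsum s (fun m => x (k + (r + m))%nat)) in H3 by lra.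
  lra.
Qed.

(** These weights give equality in [ln y <= y - 1] at each of the first [k] entries. The level [b]
    is left free, at least the average, so that small positive values serve when the average is
    0. *)
Lemma gamma_lower k r s x b :
  nonincreasing (k + r + s) x ->
  (forall i, (i < k)%nat -> b <= x i) -> 0 < b ->
  rsum (r + s) (fun m => x (k + m)%nat) <= INR r * b ->
  exists w, nondecreasing (k + r + s) w /\ (forall i, 0 < w i) /\
    rsum (k + r + s) (fun i => w i * x i) <= INR (k + r) /\
    - rsum (k + r) (fun i => ln (w i)) = rsum k (fun i => ln (x i)) + INR r * ln b.
Proof.
  intros Hx Hxb Hb Hsum.
  set (w := fun i => if Nat.ltb i k then / Rmax b (x i) else / b).
  assert (Hwk : forall i, (i < k)%nat -> w i = / x i).
  { intros i Hi. unfold w. destruct (Nat.ltb_spec i k); [|lia].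
    now rewrite Rmax_right by auto. }
  assert (Hwb : forall i, (k <= i)%nat -> w i = / b).
  { intros i Hi. unfold w. destruct (Nat.ltb_spec i k); [lia|reflexivity]. }
  exists w. split; [|split; [|split]].
  - intros i i' Hii' Hi'. destruct (Nat.lt_ge_cases i' k).
    + rewrite !Hwk by lia. apply Rinv_le_contravar.
      * apply Rlt_le_trans with b; auto.
      * apply Hx; lia.
    + rewrite (Hwb i') by assumption. destruct (Nat.lt_ge_cases i k).
      * rewrite Hwk by assumption. apply Rinv_le_contravar; auto.
      * rewrite Hwb by assumption. lra.
  - intros i. unfold w. destruct (Nat.ltb i k); apply Rinv_0_lt_compat; [|exact Hb].
    apply Rlt_le_trans with b; [exact Hb|apply Rmax_l].
  - rewrite <- Nat.add_assoc, rsum_app, plus_INR.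
    rewrite (rsum_ext k _ (fun _ => 1)).
    2:{ intros i Hi. rewrite Hwk by assumption. specialize (Hxb i Hi). field. lra. }
    rewrite (rsum_ext (r + s) _ (fun m => / b * x (k + m)%nat)).
    2:{ intros m _. rewrite Hwb by lia. reflexivity. }
    rewrite rsum_const, rsum_scal.
    apply (Rmult_le_compat_l (/ b)) in Hsum; [|apply Rlt_le, Rinv_0_lt_compat, Hb].
    replace (/ b * (INR r * b)) with (INR r) in Hsum by (field; lra). lra.
  - rewrite rsum_app.
    rewrite (rsum_ext k _ (fun i => -1 * ln (x i))).
    2:{ intros i Hi. rewrite Hwk by assumption. rewrite ln_Rinv; [ring|].
        apply Rlt_le_trans with b; auto. }
    rewrite (rsum_ext r _ (fun _ => - ln b)).
    2:{ intros m Hm. rewrite Hwb by lia. now apply ln_Rinv. }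
    rewrite rsum_scal, rsum_const. ring.
Qed.

Lemma esum_eln k f :
  match esum k (fun m => eln (f m)) with
  | Fin s => (forall i, (i < k)%nat -> 0 < f i) /\ s = rsum k (fun i => ln (f i))
  | NInf => exists i, (i < k)%nat /\ f i <= 0
  end.
Proof.
  induction k as [|k IH]; simpl.
  - split; [intros; lia|reflexivity].
  - destruct (esum k _) as [s|]; simpl.
    + destruct IH as [IH ->]. unfold eln. destruct (Rlt_dec 0 (f k)); simpl.
      * split; [|reflexivity]. intros i Hi.
        destruct (Nat.eq_dec i k) as [->|]; [assumption|apply IH; lia].
      * exists k. split; [lia|lra].
    + destruct IH as (i & Hi & Hf). exists i. split; [lia|exact Hf].
Qed.

Lemma avg_mul d j l k :
  (k <= j - 1)%nat -> (1 <= j)%nat ->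
  INR (j - k) * avg d j l k = rsum (d - k) (fun m => xo d l (k + m + 1)).
Proof.
  intros Hk Hj. unfold avg. rewrite <- Rmult_assoc, Rinv_r.
  - rewrite Rmult_1_l. apply rsum_ext; intros m _. f_equal; lia.
  - apply not_0_INR; lia.
Qed.

(** The sublevel set of [Delta_j] among positive definite matrices, with the eigenbasis hidden. *)
Definition Delta_le (d j : nat) (W : mat) (M : R) : Prop :=
  exists U w, spectrum d W U w /\ (forall i, (i < d)%nat -> 0 < w i) /\
    - rsum j (fun i => ln (w i)) <= M.

Lemma Delta_le_pos_def d j W M : Delta_le d j W M -> pos_def d W.
Proof. intros (U & w & HS & Hw & _). now apply (spectrum_pos_iff d W U w HS). Qed.

Lemma Delta_le_eigvals d j W M :
  (j <= d)%nat -> Delta_le d j W M -> exists l, eigvals d W l /\ Delta j l <= M.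
Proof.
  intros Hj (U & w & HS & _ & HM). exists (map w (seq 0 d)).
  split; [now apply spectrum_eigvals with U|now rewrite Delta_map_seq].
Qed.

Lemma eigvals_Delta_le d j W l :
  pos_def d W -> eigvals d W l -> Delta_le d j W (Delta j l).
Proof.
  intros HW Hl. destruct (eigvals_spectrum d W l Hl) as [U HS].
  exists U, (fun k => nth k l 0). split; [exact HS|split; [|apply Rle_refl]].
  now apply (spectrum_pos_iff d W U _ HS).
Qed.

Lemma Gamma_upper d j W M X l g :
  (1 <= j)%nat -> (j <= d)%nat -> Delta_le d j W M ->
  eigvals d X l -> (forall x, 0 <= quad d X x) -> gamma_rel d j l g ->
  ele g (Fin (tr d W X - INR j + M)).
Proof.
  intros Hj Hjd (U & w & (HU & HW & Hw) & Hwp & HM) Hl Hp (k & Hk & _ & Hav & ->).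
  assert (Hxp : forall i, (i < d)%nat -> 0 <= xo d l (i + 1)).
  { intros i Hi. destruct (eigvals_spectrum d X l Hl) as [V HV].
    unfold xo. rewrite <- (spectrum_quad_col d X V _ (d - (i + 1)) HV) by lia.
    apply Hp. }
  destruct (eigvals_descending d X l Hl) as (Y & HY & HX & Hx).
  pose proof (esum_eln k (fun m => xo d l (m + 1))) as He.
  destruct (esum k _) as [s|]; simpl; [|exact I].
  unfold eln. destruct (Rlt_dec 0 (avg d j l k)) as [Ha|Ha]; simpl; [|exact I].
  destruct He as [Hpos ->].
  pose proof (trace_inequality d U w Y _ HU HY Hw Hx) as Ht.
  rewrite <- (tr_ext d W _ X _ HW HX) in Ht.
  assert (Havg := avg_mul d j l k Hk Hj).
  set (r := (j - k)%nat) in *. set (t := (d - j)%nat).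
  replace (d - k)%nat with (r + t)%nat in Havg by lia.
  assert (Hd : d = (k + r + t)%nat) by lia. assert (Hjr : j = (k + r)%nat) by lia.
  pose proof (gamma_upper k r t (fun i => xo d l (i + 1)) w (avg d j l k)) as H.
  rewrite <- Hd, <- Hjr in H.
  specialize (H Hx Hw Hwp Hxp Hpos Ha ltac:(lia) Havg ltac:(lra)). lra.
Qed.

(** Stated for every real [M] above [g] rather than for [g] itself: when [g] is -∞ no single [W] is
    optimal, yet every level [M] is reached. *)
Lemma Gamma_attained d j X l g M :
  (1 <= j)%nat -> (j <= d)%nat ->
  eigvals d X l -> (forall x, 0 <= quad d X x) -> gamma_rel d j l g ->
  ele g (Fin M) ->
  exists W, Delta_le d j W M /\ tr d W X <= INR j.
Proof.
  intros Hj Hjd Hl Hp (k & Hk & Hk0 & Hav & ->) HM.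
  assert (Hxp : forall i, (i < d)%nat -> 0 <= xo d l (i + 1)).
  { intros i Hi. destruct (eigvals_spectrum d X l Hl) as [V HV].
    unfold xo. rewrite <- (spectrum_quad_col d X V _ (d - (i + 1)) HV) by lia.
    apply Hp. }
  destruct (eigvals_descending d X l Hl) as (Y & HY & HX & Hx).
  assert (Ha0 : 0 <= avg d j l k).
  { apply Rle_trans with (xo d l (k + 1)); [apply Hxp; lia|lra]. }
  assert (Hgt : forall i, (i < k)%nat -> avg d j l k < xo d l (i + 1)).
  { intros i Hi. destruct Hk0 as [->|Hk0]; [lia|].
    apply Rlt_le_trans with (1 := Hk0).
    replace k with (k - 1 + 1)%nat at 1 by lia. apply Hx; lia. }
  assert (Hb : exists b, 0 < b /\ avg d j l k <= b /\
    (forall i, (i < k)%nat -> b <= xo d l (i + 1)) /\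
    rsum k (fun i => ln (xo d l (i + 1))) + INR (j - k) * ln b <= M).
  { pose proof (esum_eln k (fun m => xo d l (m + 1))) as He.
    destruct (esum k _) as [s|]; simpl in HM.
    2:{ destruct He as (i & Hi & Hf). specialize (Hgt i Hi). lra. }
    destruct He as [Hpos ->]. unfold eln in HM.
    destruct (Rlt_dec 0 (avg d j l k)) as [Ha|Ha]; simpl in HM.
    - exists (avg d j l k). repeat split; auto; [lra|]. intros i Hi.
      apply Rlt_le; auto.
    - set (s := rsum k (fun i => ln (xo d l (i + 1)))) in *.
      (* Here the average is 0. The bound [m] keeps [b] below the first [k] entries (any positive
         number does for [k = 0]), and the exponential brings the value down to [M]. *)
      set (m := if Nat.eqb k 0 then 1 else xo d l k).
      assert (Hm : 0 < m).
      { unfold m. destruct (Nat.eqb_spec k 0); [lra|].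
        replace k with (k - 1 + 1)%nat by lia. apply Hpos; lia. }
      assert (Hr : 0 < INR (j - k)) by (apply lt_0_INR; lia).
      exists (Rmin m (exp ((M - s) / INR (j - k)))).
      assert (Hmin : 0 < Rmin m (exp ((M - s) / INR (j - k)))).
      { apply Rmin_glb_lt; [exact Hm|apply exp_pos]. }
      split; [exact Hmin|split; [lra|split]].
      + intros i Hi. apply Rle_trans with (1 := Rmin_l _ _).
        unfold m. destruct (Nat.eqb_spec k 0); [lia|].
        replace k with (k - 1 + 1)%nat at 1 by lia. apply Hx; lia.
      + assert (Hln : ln (Rmin m (exp ((M - s) / INR (j - k)))) <= (M - s) / INR (j - k)).
        { rewrite <- (ln_exp ((M - s) / INR (j - k))) at 2.
          destruct (Rmin_r m (exp ((M - s) / INR (j - k)))) as [H|H].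
          - apply Rlt_le, ln_increasing; assumption.
          - rewrite H; apply Rle_refl. }
        apply (Rmult_le_compat_l (INR (j - k))) in Hln; [|lra].
        replace (INR (j - k) * ((M - s) / INR (j - k))) with (M - s) in Hln
          by (field; lra).
        lra. }
  destruct Hb as (b & Hb & Hab & Hbx & HbM).
  assert (Havg := avg_mul d j l k Hk Hj).
  assert (H0 : INR (j - k) * avg d j l k <= INR (j - k) * b)
    by (apply Rmult_le_compat_l; [apply pos_INR|exact Hab]).
  rewrite Havg in H0.
  set (r := (j - k)%nat) in *. set (t := (d - j)%nat).
  replace (d - k)%nat with (r + t)%nat in H0 by lia.
  assert (Hd : d = (k + r + t)%nat) by lia. assert (Hjr : j = (k + r)%nat) by lia.
  pose proof (gamma_lower k r t (fun i => xo d l (i + 1)) b) as H.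
  rewrite <- Hd, <- Hjr in H.
  destruct (H Hx Hbx Hb H0) as (w & Hw & Hwp & Hwx & HwM).
  exists (diag d Y w). split.
  - exists Y, w. repeat split; auto. lra.
  - rewrite (tr_ext d _ (diag d Y w) X _ ltac:(reflexivity) HX).
    now rewrite tr_diag_same.
Qed.

Lemma least_index (P : nat -> Prop) n :
  P n -> exists k, (k <= n)%nat /\ P k /\ (k = O \/ ~ P (k - 1)%nat).
Proof.
  induction n as [|n IH]; intros H.
  - exists O. auto.
  - destruct (classic (P n)) as [Hn|Hn].
    + destruct (IH Hn) as (k & Hk & HP). exists k. split; [lia|exact HP].
    + exists (S n). rewrite Nat.sub_succ, Nat.sub_0_r. auto.
Qed.

(** The least [k] with average at least [x_(k+1)] works. The search ends at [j - 1], where the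
    average is a tail sum containing [x_(j)]. *)
Lemma gamma_exists d j l :
  (1 <= j)%nat -> (j <= d)%nat ->
  (forall i, (i < d)%nat -> 0 <= xo d l (i + 1)) -> exists g, gamma_rel d j l g.
Proof.
  intros Hj Hjd Hx.
  destruct (least_index (fun k => avg d j l k >= xo d l (k + 1)) (j - 1)) as (k & Hk & Hav & Hk0).
  - pose proof (avg_mul d j l (j - 1) (le_n _) Hj) as H.
    replace (j - (j - 1))%nat with 1%nat in H by lia. simpl INR in H.
    rewrite Rmult_1_l in H. rewrite H.
    apply Rle_ge.
    apply Rle_trans with (xo d l (j - 1 + 0 + 1)); [right; f_equal; lia|].
    apply (rsum_ge_term (d - (j - 1)) (fun m => xo d l (j - 1 + m + 1))); [|lia].
    intros i Hi. apply Hx; lia.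
  - eexists. exists k. split; [exact Hk|split; [|split; [exact Hav|reflexivity]]].
    destruct Hk0 as [->|Hk0]; [now left|].
    destruct (Nat.eq_dec k 0) as [->|Hne]; [now left|right].
    apply Rnot_ge_lt in Hk0. replace (k - 1 + 1)%nat with k in Hk0 by lia.
    (* With [a_k] the average at [k], [(j - k + 1) a_(k-1) = x_(k) + (j - k) a_k]; minimality gives
       [a_(k-1) < x_(k)], hence [a_k < x_(k)]. *)
    assert (H1 := avg_mul d j l k Hk Hj).
    assert (H2 := avg_mul d j l (k - 1) ltac:(lia) Hj).
    replace (d - (k - 1))%nat with (1 + (d - k))%nat in H2 by lia.
    rewrite rsum_app in H2; simpl rsum in H2.
    rewrite (rsum_ext (d - k) _ (fun m => xo d l (k + m + 1))) in H2
      by (intros; f_equal; lia).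
    replace (k - 1 + 0 + 1)%nat with k in H2 by lia.
    replace (j - (k - 1))%nat with (S (j - k)) in H2 by lia.
    rewrite S_INR in H2.
    assert (0 < INR (j - k)) by (apply lt_0_INR; lia).
    nra.
Qed.
(** * Convexity of Delta_j *)

Definition comb (t : R) (A B : mat) : mat := fun a b => t * A a b + (1 - t) * B a b.

Lemma tr_comb_l d t A B X :
  tr d (comb t A B) X = t * tr d A X + (1 - t) * tr d B X.
Proof.
  unfold tr, comb. rewrite <- !rsum_scal, <- rsum_plus. apply rsum_ext; intros a _.
  rewrite <- !rsum_scal, <- rsum_plus. apply rsum_ext; intros b _. ring.
Qed.

Lemma quad_comb d t A B x :
  quad d (comb t A B) x = t * quad d A x + (1 - t) * quad d B x.
Proof.
  unfold quad, comb. rewrite <- !rsum_scal, <- rsum_plus. apply rsum_ext; intros a _.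
  rewrite <- !rsum_scal, <- rsum_plus. apply rsum_ext; intros b _. ring.
Qed.

Lemma pos_def_comb d t A B :
  0 <= t <= 1 -> pos_def d A -> pos_def d B -> pos_def d (comb t A B).
Proof.
  intros Ht [HA HA'] [HB HB']. split.
  - intros a b Ha Hb. unfold comb. now rewrite (HA a b), (HB a b).
  - intros x Hx. rewrite quad_comb.
    specialize (HA' x Hx). specialize (HB' x Hx). nra.
Qed.

(** With [u] the eigenvalues of the mixture, pairing with [X] gives exactly [j] at the mixture and
    at least [j - M - sum_i ln u_i] over [i < j] at [A] and [B]; linearity of the trace then bounds
    [- sum_i ln u_i] by [M]. *)
Lemma Delta_le_comb d j A B M t :
  (j <= d)%nat -> 0 <= t <= 1 ->
  Delta_le d j A M -> Delta_le d j B M -> Delta_le d j (comb t A B) M.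
Proof.
  intros Hjd Ht HA HB.
  assert (Hpd : pos_def d (comb t A B)).
  { apply pos_def_comb; eauto using Delta_le_pos_def. }
  destruct (symmetric_spectrum d _ (proj1 Hpd)) as (V & u & HS).
  pose proof (proj1 (spectrum_pos_iff d _ V u HS) Hpd) as Hu.
  exists V, u. split; [exact HS|split; [exact Hu|]].
  (* [X] is a subgradient of [Delta_j] at [comb t A B], up to sign *)
  set (x := fun i => if Nat.ltb i j then / Rmax (u O) (u i) else 0).
  destruct HS as (HV & HW & Hu').
  assert (Hxj : forall i, (i < j)%nat -> x i = / u i).
  { intros i Hi. unfold x. destruct (Nat.ltb_spec i j); [|lia].
    rewrite Rmax_right; [reflexivity|apply Hu'; lia]. }
  assert (Hx0 : forall i, (j <= i)%nat -> x i = 0).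
  { intros i Hi. unfold x. destruct (Nat.ltb_spec i j); [lia|reflexivity]. }
  assert (Hx : nonincreasing d x).
  { intros a b Hab Hb. destruct (Nat.lt_ge_cases b j).
    - rewrite !Hxj by lia. apply Rinv_le_contravar; [apply Hu; lia|apply Hu'; lia].
    - rewrite (Hx0 b) by assumption. destruct (Nat.lt_ge_cases a j).
      + rewrite Hxj by assumption. apply Rlt_le, Rinv_0_lt_compat, Hu; lia.
      + rewrite Hx0 by assumption; lra. }
  assert (Hsplit : forall w, rsum d (fun i => w i * x i) = rsum j (fun i => w i * / u i)).
  { intros w. replace d with (j + (d - j))%nat by lia. rewrite rsum_app.
    rewrite (rsum_zero (d - j)) by (intros; rewrite Hx0 by lia; ring).
    rewrite Rplus_0_r. apply rsum_ext; intros i Hi. now rewrite Hxj. }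
  assert (Hlow : forall W, Delta_le d j W M ->
    INR j - M - rsum j (fun i => ln (u i)) <= tr d W (diag d V x)).
  { intros W (U & w & (HU & HWU & Hw) & Hwp & HwM).
    pose proof (trace_inequality d U w V x HU HV Hw Hx) as H.
    rewrite <- (tr_ext d W _ (diag d V x) _ HWU ltac:(reflexivity)), Hsplit in H.
    assert (INR j + rsum j (fun i => ln (w i)) - rsum j (fun i => ln (u i)) <=
      rsum j (fun i => w i * / u i)); [|lra].
    rewrite <- (Rmult_1_r (INR j)), <- rsum_const, <- rsum_plus, <- rsum_minus.
    apply rsum_le; intros i Hi.
    assert (0 < w i) by (apply Hwp; lia). assert (0 < u i) by (apply Hu; lia).
    pose proof (ln_le_sub1 (w i * / u i)
      ltac:(apply Rmult_lt_0_compat; [|apply Rinv_0_lt_compat]; assumption)) as Hln.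
    rewrite ln_mult, ln_Rinv in Hln by (try apply Rinv_0_lt_compat; assumption). lra. }
  pose proof (Hlow A HA). pose proof (Hlow B HB).
  assert (Htr : tr d (comb t A B) (diag d V x) = INR j).
  { rewrite (tr_ext d _ _ (diag d V x) _ HW ltac:(reflexivity)), tr_diag_same, Hsplit
      by assumption.
    rewrite (rsum_ext j _ (fun _ => 1)), rsum_const; [ring|].
    intros i Hi. apply Rinv_r. assert (0 < u i) by (apply Hu; lia). lra. }
  rewrite tr_comb_l in Htr. nra.
Qed.

Lemma Delta_le_scale d j W M s :
  (j <= d)%nat -> 0 < s -> Delta_le d j W M ->
  Delta_le d j (fun a b => s * W a b) (M - INR j * ln s).
Proof.
  intros Hjd Hs (U & w & (HU & HW & Hw) & Hwp & HM).
  exists U, (fun i => s * w i). split; [split; [exact HU|split]|split].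
  - intros a b Ha Hb. rewrite HW by assumption. unfold diag. rewrite <- rsum_scal.
    apply rsum_ext; intros; ring.
  - intros a b Hab Hb. apply Rmult_le_compat_l; [lra|apply Hw; assumption].
  - intros i Hi. apply Rmult_lt_0_compat; auto.
  - rewrite (rsum_ext j _ (fun i => ln s + ln (w i))).
    + rewrite rsum_plus, rsum_const. lra.
    + intros i Hi. apply ln_mult; [exact Hs|apply Hwp; lia].
Qed.

Lemma quad_scale_mat d s W x :
  quad d (fun a b => s * W a b) x = s * quad d W x.
Proof.
  unfold quad. rewrite <- rsum_scal. apply rsum_ext; intros a _.
  rewrite <- rsum_scal. apply rsum_ext; intros b _. ring.
Qed.

(** * A minimax theorem by multiplicative weights *)

(** [exp y <= 1 / (1 - y)], and [(1 + y + 2 y^2) (1 - y) = 1 + y^2 (1 - 2 y) >= 1] on this range. *)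
Lemma exp_le_quadratic y : 0 <= y <= /2 -> exp y <= 1 + y + 2 * y^2.
Proof.
  intros Hy. pose proof (exp_ineq1_le (- y)) as H.
  assert (He : exp y * exp (- y) = 1) by (rewrite <- exp_plus, Rplus_opp_r; apply exp_0).
  pose proof (exp_pos y).
  assert (H1 : exp y * (1 - y) <= 1) by nra.
  assert (1 <= (1 + y + 2 * y^2) * (1 - y)) by nra. nra.
Qed.

(* The multiplicative weights update: [u] is the running average of the answers
   to the distributions proportional to [exp (eta * T * u i)]. *)
Lemma multiplicative_weights n (K : (nat -> R) -> Prop) rho G eta T :
  (0 < n)%nat ->
  (forall u u' t, K u -> K u' -> 0 <= t <= 1 -> K (fun i => t * u i + (1 - t) * u' i)) ->
  (forall p, (forall i, (i < n)%nat -> 0 <= p i) -> rsum n p = 1 ->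
    exists u, K u /\ (forall i, (i < n)%nat -> 0 <= u i <= G) /\
      rsum n (fun i => p i * u i) <= rho) ->
  0 < eta -> eta * G <= /2 ->
  exists u, K u /\
    rsum n (fun i => exp (eta * INR (S T) * u i)) <=
    INR n * exp (INR (S T) * (eta * rho + 2 * (eta * G)^2)).
Proof.
  intros Hn HK Hans Heta HG.
  (* One round: answering the normalized weights [q] lets the total weight grow by at most the fixed
     factor on the right. *)
  assert (Hstep : forall q, (forall i, (i < n)%nat -> 0 < q i) ->
    exists u, K u /\ rsum n (fun i => q i * exp (eta * u i)) <=
      rsum n q * exp (eta * rho + 2 * (eta * G)^2)).
  { intros q Hq.
    assert (Hs : 0 < rsum n q).
    { apply Rlt_le_trans with (q O); [auto|].
      apply rsum_ge_term; [intros; apply Rlt_le; auto|exact Hn]. }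
    destruct (Hans (fun i => q i / rsum n q)) as (u & Ku & HuG & Hurho).
    - intros i Hi. apply Rlt_le, Rdiv_lt_0_compat; auto.
    - unfold Rdiv. rewrite rsum_scal_r. apply Rinv_r; lra.
    - exists u. split; [exact Ku|].
      apply Rle_trans with (rsum n (fun i => q i * (1 + 2 * (eta * G)^2) +
        eta * rsum n q * (q i / rsum n q * u i))).
      + apply rsum_le; intros i Hi. specialize (HuG i Hi). specialize (Hq i Hi).
        replace (eta * rsum n q * (q i / rsum n q * u i)) with (q i * (eta * u i))
          by (field; lra).
        rewrite <- Rmult_plus_distr_l. apply Rmult_le_compat_l; [lra|].
        assert (0 <= eta * u i <= eta * G)
          by (split; [apply Rmult_le_pos|apply Rmult_le_compat_l]; lra).
        pose proof (exp_le_quadratic (eta * u i) ltac:(lra)).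
        assert ((eta * u i)^2 <= (eta * G)^2) by (apply pow_incr; lra). lra.
      + rewrite rsum_plus, rsum_scal_r, rsum_scal, Rmult_comm.
        apply Rle_trans with (rsum n q * (1 + (eta * rho + 2 * (eta * G)^2))).
        * assert (eta * rsum n q * rsum n (fun i => q i / rsum n q * u i) <=
            eta * rsum n q * rho); [|lra].
          apply Rmult_le_compat_l; [|exact Hurho]. apply Rmult_le_pos; lra.
        * apply Rmult_le_compat_l; [lra|]. apply exp_ineq1_le. }
  induction T as [|T (u & Ku & Hu)].
  - destruct (Hstep (fun _ => 1)) as (u & Ku & Hu); [intros; lra|].
    exists u. split; [exact Ku|]. rewrite rsum_const in Hu. simpl INR.
    rewrite Rmult_1_l, !Rmult_1_r in *.
    rewrite (rsum_ext n _ (fun i => 1 * exp (eta * u i))) by (intros; ring). exact Hu.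
  - destruct (Hstep (fun i => exp (eta * INR (S T) * u i))) as (u' & Ku' & Hu').
    { intros; apply exp_pos. }
    (* The weight that makes the mixture the mean of [T + 2] answers, so that the exponents of the
       old total and of the new round add up. *)
    set (t := INR (S T) / INR (S (S T))).
    assert (HT : 0 < INR (S T)) by (apply lt_0_INR; lia).
    assert (HT' : INR (S (S T)) = INR (S T) + 1) by apply S_INR.
    exists (fun i => t * u i + (1 - t) * u' i). split.
    + apply HK; auto. unfold t. split.
      * apply Rlt_le, Rdiv_lt_0_compat; lra.
      * apply Rmult_le_reg_r with (INR (S (S T))); [lra|].
        unfold Rdiv. rewrite Rmult_assoc, Rinv_l; lra.
    + rewrite (rsum_ext n _ (fun i => exp (eta * INR (S T) * u i) * exp (eta * u' i))).
      * apply Rle_trans with (1 := Hu').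
        rewrite HT', Rmult_plus_distr_r, Rmult_1_l,
          (exp_plus (INR (S T) * _)), <- Rmult_assoc.
        apply Rmult_le_compat_r; [apply Rlt_le, exp_pos|exact Hu].
      * intros i _. rewrite <- exp_plus. f_equal. unfold t. rewrite HT'. field. lra.
Qed.

(** Each term is at most the total weight, so after [N] rounds
    [u_i <= rho + ln n / (N eta) + 2 eta G^2]. First [eta], then [N], is chosen to make each error
    at most [eps / 2]; [eta G <= 1/2] keeps the exponents in the range of the quadratic bound. *)
Lemma minimax_convex n (K : (nat -> R) -> Prop) rho G eps :
  (0 < n)%nat ->
  (forall u u' t, K u -> K u' -> 0 <= t <= 1 -> K (fun i => t * u i + (1 - t) * u' i)) ->
  (forall p, (forall i, (i < n)%nat -> 0 <= p i) -> rsum n p = 1 ->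
    exists u, K u /\ (forall i, (i < n)%nat -> 0 <= u i <= G) /\
      rsum n (fun i => p i * u i) <= rho) ->
  0 < G -> 0 < eps ->
  exists u, K u /\ forall i, (i < n)%nat -> u i <= rho + eps.
Proof.
  intros Hn HK Hans HG Heps.
  set (eta := Rmin (/ (2 * G)) (eps / (4 * G^2))).
  assert (HGG : 0 < G^2) by (apply pow_lt; exact HG).
  assert (Heta : 0 < eta).
  { apply Rmin_glb_lt; [apply Rinv_0_lt_compat|apply Rdiv_lt_0_compat]; lra. }
  assert (H1 : eta * G <= /2).
  { apply Rle_trans with (/ (2 * G) * G); [|right; field; lra].
    apply Rmult_le_compat_r; [lra|apply Rmin_l]. }
  assert (H2 : 2 * eta * G^2 <= eps / 2).
  { apply Rle_trans with (2 * (eps / (4 * G^2)) * G^2); [|right; field; lra].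
    apply Rmult_le_compat_r; [lra|]. apply Rmult_le_compat_l; [lra|apply Rmin_r]. }
  destruct (INR_unbounded (2 * ln (INR n) / (eta * eps))) as [T HT].
  destruct (multiplicative_weights n K rho G eta T Hn HK Hans Heta H1) as (u & Ku & Hu).
  exists u. split; [exact Ku|]. intros i Hi.
  set (N := INR (S T)) in *.
  assert (HN : 2 * ln (INR n) <= N * (eta * eps)).
  { assert (T_N : INR T <= N) by (apply le_INR; lia).
    assert (Hee : 0 < eta * eps) by now apply Rmult_lt_0_compat.
    apply Rle_trans with (2 * ln (INR n) / (eta * eps) * (eta * eps)).
    - right; field; lra.
    - apply Rmult_le_compat_r; lra. }
  assert (HNpos : 0 < N) by (apply lt_0_INR; lia).
  assert (Hnpos : 0 < INR n) by (apply lt_0_INR; lia).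
  assert (H3 : exp (eta * N * u i) <=
    exp (ln (INR n) + N * (eta * rho + 2 * (eta * G)^2))).
  { rewrite exp_plus, exp_ln by exact Hnpos.
    apply Rle_trans with (2 := Hu).
    apply (rsum_ge_term n (fun i => exp (eta * N * u i))); [|exact Hi].
    intros; apply Rlt_le, exp_pos. }
  assert (H4 : eta * N * u i <= ln (INR n) + N * (eta * rho + 2 * (eta * G)^2)).
  { apply Rnot_lt_le. intros H. apply exp_increasing in H. lra. }
  assert (HNe : 0 < N * eta) by now apply Rmult_lt_0_compat.
  apply Rmult_le_reg_l with (N * eta); [exact HNe|].
  apply (Rmult_le_compat_l (N * eta)) in H2; [|lra]. lra.
Qed.

(** * Duality *)

(** The link between the programs: the constraint values of (P) averaged with the multipliers
    [c]. *)
Lemma tr_Xc n d v W c :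
  tr d W (Xc n v c) = rsum n (fun i => c i * quad d W (v i)).
Proof.
  unfold tr, Xc, quad. setoid_rewrite <- rsum_scal.
  transitivity (rsum d (fun a => rsum n (fun i => rsum d (fun b =>
    W a b * (c i * v i a * v i b))))).
  { apply rsum_ext; intros a _. apply rsum_swap. }
  rewrite rsum_swap. apply rsum_ext; intros i _.
  apply rsum_ext; intros a _. rewrite <- rsum_scal.
  apply rsum_ext; intros b _. ring.
Qed.

Lemma Xc_symmetric n d v c : symmetric d (Xc n v c).
Proof. intros a b _ _. apply rsum_ext; intros; ring. Qed.

Lemma Xc_psd n d v c x :
  (forall i, (i < n)%nat -> 0 <= c i) -> 0 <= quad d (Xc n v c) x.
Proof.
  intros Hc.
  replace (quad d (Xc n v c) x) with (rsum n (fun i => c i * (dot d (v i) x)^2)).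
  { apply rsum_nonneg; intros i Hi. apply Rmult_le_pos; [auto|apply pow2_ge_0]. }
  (* The form at [x] is the trace against [x x^T], so [tr_Xc] applies. *)
  transitivity (tr d (fun a b => x a * x b) (Xc n v c)).
  - rewrite tr_Xc. apply rsum_ext; intros i _. f_equal.
    unfold dot, quad. simpl. rewrite Rmult_1_r, rsum_mul.
    apply rsum_ext; intros a _. apply rsum_ext; intros b _. ring.
  - apply rsum_ext; intros a _. apply rsum_ext; intros b _. ring.
Qed.

Lemma Gamma_exists n d j v c :
  (1 <= j)%nat -> (j <= d)%nat -> (forall i, (i < n)%nat -> 0 <= c i) ->
  exists g, Gamma_rel d j (Xc n v c) g.
Proof.
  intros Hj Hjd Hc.
  destruct (symmetric_spectrum d _ (Xc_symmetric n d v c)) as (U & w & HS).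
  destruct (gamma_exists d j (map w (seq 0 d)) Hj Hjd) as [g Hg].
  - intros i Hi. unfold xo. rewrite nth_map_seq by lia.
    rewrite <- (spectrum_quad_col d _ U w _ HS) by lia. now apply Xc_psd.
  - exists g, (map w (seq 0 d)). split; [now apply spectrum_eigvals with U|exact Hg].
Qed.

Lemma Gamma_Xc_upper n d j v c g W M :
  (1 <= j)%nat -> (j <= d)%nat -> (forall i, (i < n)%nat -> 0 <= c i) ->
  Gamma_rel d j (Xc n v c) g -> Delta_le d j W M ->
  ele g (Fin (tr d W (Xc n v c) - INR j + M)).
Proof.
  intros Hj Hjd Hc (l & Hl & Hg) HW.
  eapply Gamma_upper; eauto. intros; now apply Xc_psd.
Qed.

(** Reduces comparisons to real levels, the shape that [Gamma_attained] requires, also when [b] is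
    -∞. *)
Lemma ele_of_upper_bounds a b :
  (forall M, ele b (Fin M) -> ele a (Fin M)) -> ele a b.
Proof.
  destruct b as [y|]; intros H.
  - apply H. apply Rle_refl.
  - destruct a as [x|]; [|exact I]. specialize (H (x - 1) I). simpl in H. lra.
Qed.

Lemma ele_trans a b c : ele a b -> ele b c -> ele a c.
Proof. destruct a, b, c; simpl; try tauto. apply Rle_trans. Qed.

Lemma Gamma_is_concave n d j v :
  (1 <= j)%nat -> (j <= d)%nat -> Gamma_concave n d j v.
Proof.
  intros Hj Hjd c c' t g g' g'' [_ Hc] [_ Hc'] Ht Hg Hg' (l & Hl & Hg'').
  apply ele_of_upper_bounds. intros M HM.
  (* One [W], nearly optimal at the mixture, serves as an upper bound at both endpoints, and the
     trace is linear in [c]. *)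
  destruct (Gamma_attained d j _ l g'' M Hj Hjd Hl) as (W & HW & Htr); auto.
  { intros x. apply Xc_psd. intros i Hi. specialize (Hc i Hi). specialize (Hc' i Hi).
    assert (0 <= t * c i) by (apply Rmult_le_pos; lra).
    assert (0 <= (1 - t) * c' i) by (apply Rmult_le_pos; lra). lra. }
  pose proof (Gamma_Xc_upper n d j v c g W M Hj Hjd Hc Hg HW) as H1.
  pose proof (Gamma_Xc_upper n d j v c' g' W M Hj Hjd Hc' Hg' HW) as H2.
  rewrite tr_Xc in Htr, H1, H2.
  rewrite (rsum_ext n _ (fun i => t * (c i * quad d W (v i)) +
    (1 - t) * (c' i * quad d W (v i)))) in Htr by (intros; ring).
  rewrite rsum_plus, !rsum_scal in Htr.
  destruct g as [g|], g' as [g'|]; simpl in *; try exact I.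
  apply (Rmult_le_compat_l t) in H1; [|lra].
  apply (Rmult_le_compat_l (1 - t)) in H2; [|lra]. lra.
Qed.

Lemma weak_duality n d j v g p :
  (1 <= j)%nat -> (j <= d)%nat -> Dvals n d j v g -> Pvals n d j v p -> ele g p.
Proof.
  intros Hj Hjd (c & [Hsum Hc] & Hg) (W & l & HW & Hfeas & Hl & ->).
  apply ele_trans with (1 := Gamma_Xc_upper n d j v c g W _ Hj Hjd Hc Hg
    (eigvals_Delta_le d j W l HW Hl)).
  simpl. assert (tr d W (Xc n v c) <= INR j); [|lra].
  rewrite tr_Xc, <- Hsum. apply rsum_le; intros i Hi.
  specialize (Hc i Hi). specialize (Hfeas i Hi). nra.
Qed.

Lemma Pvals_of_Delta_le n d j v W M :
  (j <= d)%nat -> Delta_le d j W M ->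
  (forall i, (i < n)%nat -> quad d W (v i) <= 1) ->
  exists p, Pvals n d j v (Fin p) /\ p <= M.
Proof.
  intros Hjd HW Hfeas. destruct (Delta_le_eigvals d j W M Hjd HW) as (l & Hl & HM).
  exists (Delta j l). split; [|exact HM].
  exists W, l. split; [now apply Delta_le_pos_def with j M|auto].
Qed.

Lemma Delta_le_inhabited d j : exists W M, Delta_le d j W M.
Proof.
  (* The zero matrix only supplies some orthonormal [U]; the witness is [U U^T]. *)
  destruct (symmetric_spectrum d (fun _ _ => 0)) as (U & _ & HU & _ & _).
  { intros a b _ _; reflexivity. }
  exists (diag d U (fun _ => 1)), (- rsum j (fun _ => ln 1)), U, (fun _ => 1).
  repeat split; auto using Rle_refl; intros; [intros ? ? ? ?; lra|lra].
Qed.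

(** Shrinking any positive definite matrix makes it feasible. By weak duality this bounds (D) above,
    as [completeness] requires. *)
Lemma Pvals_inhabited n d j v : (j <= d)%nat -> exists p, Pvals n d j v (Fin p).
Proof.
  intros Hjd. destruct (Delta_le_inhabited d j) as (W & M & HW).
  set (q := rsum n (fun i => Rabs (quad d W (v i)))).
  assert (Hq : 0 <= q) by (apply rsum_nonneg; intros; apply Rabs_pos).
  assert (Hs : 0 < / (1 + q)) by (apply Rinv_0_lt_compat; lra).
  destruct (Pvals_of_Delta_le n d j v _ _ Hjd (Delta_le_scale d j W M _ Hjd Hs HW))
    as (p & Hp & _); [|now exists p].
  intros i Hi. rewrite quad_scale_mat.
  assert (quad d W (v i) <= q).
  { apply Rle_trans with (1 := Rle_abs _).
    apply (rsum_ge_term n (fun i => Rabs (quad d W (v i)))); [|exact Hi].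
    intros; apply Rabs_pos. }
  apply Rmult_le_reg_l with (1 + q); [lra|].
  rewrite <- Rmult_assoc, Rinv_r, Rmult_1_r; lra.
Qed.

(* The multipliers are kept away from the boundary by mixing in the uniform
   distribution with weight [theta]; complementarity [tr (W X) <= j] then bounds
   the constraint values of best responses. *)
Lemma near_feasible n d j v S r :
  (1 <= j)%nat -> (j <= d)%nat -> (0 < n)%nat ->
  (forall g, Dvals n d j v g -> ele g (Fin S)) -> 1 < r ->
  exists W, Delta_le d j W S /\ forall i, (i < n)%nat -> quad d W (v i) <= r.
Proof.
  intros Hj Hjd Hn HS Hr.
  set (K := fun u : nat -> R => exists W, Delta_le d j W S /\
    forall i, (i < n)%nat -> u i = quad d W (v i)).
  (* The slack [r - 1] is halved: one half pays for mixing in the uniform distribution, since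
     [(1 - theta) rho = 1], the other is the minimax error [r - rho]. *)
  set (rho := (1 + r) / 2).
  set (theta := 1 - / rho).
  assert (Hrho : 1 < rho) by (unfold rho; lra).
  assert (Hth : 0 < theta /\ theta < 1 /\ (1 - theta) * rho = 1).
  { unfold theta. assert (/ rho < 1) by (rewrite <- Rinv_1; apply Rinv_lt_contravar; lra).
    assert (0 < / rho) by (apply Rinv_0_lt_compat; lra).
    split; [lra|split; [lra|]]. field; lra. }
  destruct Hth as (Hth0 & Hth1 & Hth).
  assert (Hnp : 0 < INR n) by (apply lt_0_INR; lia).
  assert (Hjp : 0 < INR j) by (apply lt_0_INR; lia).
  (* The bound [n / theta] comes from [c_i >= j theta / n] and [c_i v_i^T W v_i <= j]. *)
  destruct (minimax_convex n K rho (INR n / theta) (r - rho)) as (u & (W & HW & HuW) & Hu).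
  - exact Hn.
  - intros u u' t (A & HA & Hu) (B & HB & Hu') Ht.
    exists (comb t A B). split; [now apply Delta_le_comb|].
    intros i Hi. now rewrite quad_comb, Hu, Hu'.
  - intros p Hp Hsum.
    set (c := fun i => INR j * (theta / INR n + (1 - theta) * p i)).
    assert (Htn : 0 < theta / INR n) by (apply Rdiv_lt_0_compat; lra).
    assert (Hc : forall i, (i < n)%nat -> 0 <= c i).
    { intros i Hi. specialize (Hp i Hi). apply Rmult_le_pos; [lra|].
      assert (0 <= (1 - theta) * p i) by (apply Rmult_le_pos; lra). lra. }
    assert (HD : Dfeasible n j c).
    { split; [|exact Hc]. unfold c.
      rewrite rsum_scal, rsum_plus, rsum_const, rsum_scal, Hsum. field. lra. }
    destruct (Gamma_exists n d j v c Hj Hjd Hc) as (g & l & Hl & Hg).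
    destruct (Gamma_attained d j _ l g S Hj Hjd Hl) as (W & HW & Htr); auto.
    { intros x. now apply Xc_psd. }
    { apply HS. exists c. split; [exact HD|]. now exists l. }
    assert (Hq : forall i, (i < n)%nat -> 0 <= quad d W (v i)).
    { intros i _. destruct HW as (U & w & (HU & HWU & _) & Hw & _).
      rewrite (quad_ext d W _ _ HWU), quad_diag. apply rsum_nonneg; intros k Hk.
      apply Rmult_le_pos; [apply Rlt_le; auto|apply pow2_ge_0]. }
    rewrite tr_Xc in Htr.
    exists (fun i => quad d W (v i)). split; [now exists W|split].
    + intros i Hi. split; [auto|].
      assert (H1 : c i * quad d W (v i) <= INR j).
      { apply Rle_trans with (2 := Htr).
        apply (rsum_ge_term n (fun i => c i * quad d W (v i))); [|exact Hi].
        intros; apply Rmult_le_pos; auto. }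
      assert (H2 : INR j * (theta / INR n) * quad d W (v i) <= INR j).
      { apply Rle_trans with (2 := H1). apply Rmult_le_compat_r; [auto|].
        unfold c. apply Rmult_le_compat_l; [lra|].
        specialize (Hp i Hi). assert (0 <= (1 - theta) * p i) by (apply Rmult_le_pos; lra).
        lra. }
      apply Rmult_le_reg_l with (INR j * (theta / INR n)).
      * now apply Rmult_lt_0_compat.
      * apply Rle_trans with (1 := H2). right; field; lra.
    + set (s := rsum n (fun i => p i * quad d W (v i))).
      assert (H1 : INR j * (1 - theta) * s <= INR j).
      { apply Rle_trans with (2 := Htr). unfold s. rewrite <- rsum_scal.
        apply rsum_le; intros i Hi. rewrite <- Rmult_assoc.
        apply Rmult_le_compat_r; [auto|]. unfold c. nra. }
      apply Rmult_le_reg_l with (INR j * (1 - theta)).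
      * apply Rmult_lt_0_compat; lra.
      * rewrite (Rmult_assoc (INR j) _ rho), Hth. lra.
  - apply Rdiv_lt_0_compat; lra.
  - unfold rho; lra.
  - exists W. split; [exact HW|]. intros i Hi. rewrite <- HuW by assumption.
    specialize (Hu i Hi). lra.
Qed.

(** [S] is any real upper bound of (D), so the same statement shows (P) unbounded below when (D) has
    value -∞. *)
Lemma strong_duality n d j v S eps :
  (1 <= j)%nat -> (j <= d)%nat ->
  (forall g, Dvals n d j v g -> ele g (Fin S)) -> 0 < eps ->
  exists p, Pvals n d j v (Fin p) /\ p <= S + eps.
Proof.
  intros Hj Hjd HS Heps.
  assert (Hjp : 0 < INR j) by (apply lt_0_INR; lia).
  destruct (Nat.eq_dec n 0) as [->|Hn].
  (* Without vectors (D) is infeasible and (P) unconstrained; scaling moves the bound [M] to exactly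
     [S]. *)
  - destruct (Delta_le_inhabited d j) as (W & M & HW).
    destruct (Pvals_of_Delta_le 0 d j v _ _ Hjd
      (Delta_le_scale d j W M (exp ((M - S) / INR j)) Hjd (exp_pos _) HW))
      as (p & Hp & HpM); [intros; lia|].
    exists p. split; [exact Hp|]. rewrite ln_exp in HpM.
    replace (INR j * ((M - S) / INR j)) with (M - S) in HpM by (field; lra). lra.
  (* Chosen so that the final division of [W] by [r] costs [j ln r = eps]. *)
  - set (r := exp (eps / INR j)).
    assert (Hr : 1 < r).
    { unfold r. rewrite <- exp_0. apply exp_increasing, Rdiv_lt_0_compat; lra. }
    destruct (near_feasible n d j v S r Hj Hjd ltac:(lia) HS Hr) as (W & HW & Hq).
    destruct (Pvals_of_Delta_le n d j v _ _ Hjd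
      (Delta_le_scale d j W S (/ r) Hjd ltac:(apply Rinv_0_lt_compat; lra) HW))
      as (p & Hp & HpM).
    + intros i Hi. rewrite quad_scale_mat.
      apply Rmult_le_reg_l with r; [lra|]. rewrite <- Rmult_assoc, Rinv_r by lra.
      specialize (Hq i Hi). lra.
    + exists p. split; [exact Hp|]. rewrite ln_Rinv in HpM by lra.
      unfold r in HpM. rewrite ln_exp in HpM.
      replace (INR j * - (eps / INR j)) with (- eps) in HpM by (field; lra). lra.
Qed.

Theorem theorem4p4 (n d j : nat) (v : nat -> vec)
    (Hj1 : (1 <= j)%nat) (Hjd : (j <= d)%nat) :
  Gamma_concave n d j v /\
  exists opt : ereal, is_inf (Pvals n d j v) opt /\ is_sup (Dvals n d j v) opt.
Proof.
  split; [now apply Gamma_is_concave|].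
  (* The second case covers both an infeasible (D) and one whose objective is -∞ throughout. *)
  destruct (classic (exists r, Dvals n d j v (Fin r))) as [[r0 Hr0]|Hno].
  - destruct (Pvals_inhabited n d j v Hjd) as [p0 Hp0].
    destruct (completeness (fun r => Dvals n d j v (Fin r))) as [S [Hub Hlub]].
    + exists p0. intros r Hr. exact (weak_duality n d j v _ _ Hj1 Hjd Hr Hp0).
    + now exists r0.
    + assert (HS : forall g, Dvals n d j v g -> ele g (Fin S)).
      { intros [g|] Hg; [now apply Hub|exact I]. }
      exists (Fin S). split; split.
      * intros s Hs. pose proof Hs as (W & l & _ & _ & _ & ->).
        apply Hlub. intros r Hr. exact (weak_duality n d j v _ _ Hj1 Hjd Hr Hs).
      * intros [w|] Hw; [|exact I]. simpl. apply Rnot_lt_le; intros Hlt.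
        destruct (strong_duality n d j v S ((w - S) / 2) Hj1 Hjd HS ltac:(lra))
          as (p & Hp & HpS).
        specialize (Hw _ Hp). simpl in Hw. lra.
      * exact HS.
      * intros [w|] Hw; [|exact (Hw _ Hr0)]. apply Hlub. intros r Hr. exact (Hw _ Hr).
  - assert (HN : forall g, Dvals n d j v g -> g = NInf).
    { intros [r|] Hg; [exfalso; eauto|reflexivity]. }
    exists NInf. split; split.
    + intros s _. exact I.
    + intros [w|] Hw; [|exact I].
      (* Every real bounds (D) here; [w - 2] with error 1 yields a value of (P) below the supposed
         lower bound [w]. *)
      destruct (strong_duality n d j v (w - 2) 1 Hj1 Hjd) as (p & Hp & HpS); [|lra|].
      * intros g Hg. rewrite (HN g Hg). exact I.
      * specialize (Hw _ Hp). simpl in Hw. lra.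
    + intros s Hs. rewrite (HN s Hs). exact I.
    + intros w _. exact I.
Qed.
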